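(* Let $N>1$ be a real number and let $(M,d,\mathsf m)$ be a metric measure space satisfying the $\mathsf{CD}(0,N)$ condition and having Euclidean volume growth, i.e. $\mathsf{AVR}_{M,d,\mathsf m}>0$. Then for every bounded Borel subset $\Omega\subset M$, $$\mathsf m^+(\Omega)\ \geq\ N\,\omega_N^{\frac1N}\,\mathsf{AVR}_{M,d,\mathsf m}^{\frac1N}\,\mathsf m(\Omega)^{\frac{N-1}{N}}.$$ Moreover, this inequality is sharp: the constant $N\omega_N^{1/N}\mathsf{AVR}_{M,d,\mathsf m}^{1/N}$ cannot be replaced by any larger constant (for the given space $(M,d,\mathsf m)$) so that the inequality still holds for all bounded Borel subsets $\Omega\subset M$.
   Context: A metric measure space $(M,d,\mathsf m)$ here means: $(M,d)$ is a complete separable metric space which is geodesic (any two points $x,y$ are joined by a minimizing geodesic $\gamma:[0,1]\to M$ parametrized proportionally to arclength with $\gamma(0)=x$, $\gamma(1)=y$), and $\mathsf m$ is a locally finite Borel measure on $M$ with $\mathrm{supp}[\mathsf m]=M$. $P_2(M,d)$ is the $L^2$-Wasserstein space of probability measures on $M$, and $P_2(M,d,\mathsf m)$ is its subspace of $\mathsf m$-absolutely continuous measures. For $N\ge 1$ the Rényi entropy functional is $$\mathrm{Ent}_N(\mu|\mathsf m)=-\int_M\rho^{1-\frac1N}\,d\mathsf m,$$ where $\rho$ is the density of the absolutely continuous part in the Lebesgue decomposition $\mu=\rho\,\mathsf m+\mu^{s}$ of $\mu\in P_2(M,d)$. The curvature-dimension condition $\mathsf{CD}(0,N)$ states that for all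 $N'\ge N$ the functional $\mathrm{Ent}_{N'}(\cdot|\mathsf m)$ is convex on $P_2(M,d,\mathsf m)$, i.e. for each $\mu_0,\mu_1\in P_2(M,d,\mathsf m)$ there exists a geodesic $\Gamma:[0,1]\to P_2(M,d,\mathsf m)$ joining $\mu_0$ and $\mu_1$ such that for every $s\in[0,1]$, $$\mathrm{Ent}_{N'}(\Gamma(s)|\mathsf m)\le(1-s)\,\mathrm{Ent}_{N'}(\mu_0|\mathsf m)+s\,\mathrm{Ent}_{N'}(\mu_1|\mathsf m).$$ Let $B_x(r)=\{y\in M:d(x,y)<r\}$ and $\omega_N=\pi^{N/2}/\Gamma(1+N/2)$. Under $\mathsf{CD}(0,N)$ the function $r\mapsto \mathsf m(B_x(r))/r^N$ is nonincreasing on $(0,\infty)$ for every $x\in M$ (Bishop–Gromov), and the asymptotic volume ratio $$\mathsf{AVR}_{M,d,\mathsf m}=\lim_{r\to\infty}\frac{\mathsf m(B_x(r))}{\omega_N r^N}$$ exists and is independent of $x\in M$. The Minkowski content of $\Omega\subset M$ is $$\mathsf m^+(\Omega)=\liminf_{\varepsilon\to0^+}\frac{\mathsf m(\Omega_\varepsilon\setminus\Omega)}{\varepsilon},\qquad \Omega_\varepsilon=\{x\in M:\exists\, y\in\Omega\text{ such that }d(x,y)<\varepsilon\}.$$ *)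

(* Defs.v *)
From HB Require Import structures.
From mathcomp Require Import all_boot all_order all_algebra.
From mathcomp Require Import all_classical all_reals all_analysis.

Set Implicit Arguments.
Unset Strict Implicit.
Unset Printing Implicit Defensive.

Import Order.TTheory GRing.Theory Num.Theory.
Import numFieldNormedType.Exports.

Local Open Scope classical_set_scope.
Local Open Scope ring_scope.

(* [Complete] is inherited from uniform spaces (every proper Cauchy filter
   converges) and also provides a point, so the spaces are nonempty. *)
#[short(type="completeMetricType")]
HB.structure Definition CompleteMetric (K : numDomainType) :=
  {M of Metric K M & Complete M}.

Notation borel M := (g_sigma_algebraType (@open M)).

Section metric_measure_space.
Context {R : realType} {M : completeMetricType R}.
Implicit Types m : {measure set (borel M) -> \bar R}.

Definition separable := exists2 D : set M, countable D & dense D.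

Definition geodesic_space := forall x y : M, exists gamma : R -> M,
  [/\ gamma 0 = x, gamma 1 = y &
      {in `[0, 1] &, forall s t,
        mdist (gamma s) (gamma t) = `|s - t| * mdist x y}].

Definition locally_finite m :=
  forall x : M, exists2 r : R, 0 < r & (m (ball x r) < +oo)%E.

Definition full_support m := forall U : set M,
  open U -> U !=set0 -> (0 < m U)%E.

Definition mm_space m :=
  [/\ separable, geodesic_space, locally_finite m & full_support m].

End metric_measure_space.
Arguments separable {R} M.
Arguments geodesic_space {R} M.

Section wasserstein.
Context {R : realType} {M : completeMetricType R}.
Implicit Types mu nu : probability (borel M) R.
Local Open Scope ereal_scope.

Definition P2 mu :=
  exists x0 : M, \int[mu]_x ((mdist x0 x) ^+ 2)%:E < +oo.

(* On a separable M, the product sigma-algebra on [borel M * borel M] is the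
   Borel sigma-algebra of the product topology. *)
Definition coupling mu nu (q : probability (borel M * borel M)%type R) :=
  forall A : set (borel M), measurable A ->
    pushforward q fst A = mu A /\ pushforward q snd A = nu A.

Definition W2 mu nu : \bar R :=
  (ereal_inf [set \int[q]_z ((mdist (z.1 : M) (z.2 : M)) ^+ 2)%:E |
              q in coupling mu nu]) `^ 2^-1.

Definition P2ac (m : {measure set (borel M) -> \bar R}) mu :=
  P2 mu /\ mu `<< m.

(* Measures are functions on all subsets, with unspecified values outside the
   sigma-algebra; the endpoints are therefore only compared on Borel sets. *)
Definition W2_geodesic (Gamma : R -> probability (borel M) R) mu nu :=
  [/\ forall A : set (borel M), measurable A -> Gamma 0%R A = mu A,
      forall A : set (borel M), measurable A -> Gamma 1%R A = nu A &
      {in `[0%R, 1%R] &, forall s t,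
        W2 (Gamma s) (Gamma t) = `|s - t|%:E * W2 mu nu}].

End wasserstein.

Section curvature_dimension.
Context {R : realType} {M : completeMetricType R}.
Variable m : {measure set (borel M) -> \bar R}.
Local Open Scope ereal_scope.

Definition mutually_singular (mu nu : {measure set (borel M) -> \bar R}) :=
  exists A : set (borel M), [/\ measurable A, mu A = 0 & nu (~` A) = 0].

Definition lebesgue_decomposition (mu : probability (borel M) R)
    (rho : borel M -> R) (mus : {measure set (borel M) -> \bar R}) :=
  [/\ measurable_fun setT rho, forall x, (0 <= rho x)%R,
      mutually_singular mus m &
      forall A : set (borel M), measurable A ->
        mu A = \int[m]_(x in A) (rho x)%:E + mus A].

(* The density is unique up to m-null sets, so the integral defining [Ent] does
   not depend on the chosen one. *)
Definition ac_density (mu : probability (borel M) R) : borel M -> R :=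
  xget (cst 0%R) [set rho | exists mus, lebesgue_decomposition mu rho mus].

(* Intended for N > 1: at N = 1 the library convention [0 `^ 0 = 1] would make
   the integrand constant.  The value -oo is allowed. *)
Definition Ent (N : R) (mu : probability (borel M) R) : \bar R :=
  - \int[m]_x ((ac_density mu x) `^ (1 - N^-1))%:E.

Definition CD0 (N : R) := forall N' : R, (N <= N')%R ->
  forall mu0 mu1 : probability (borel M) R, P2ac m mu0 -> P2ac m mu1 ->
  exists Gamma : R -> probability (borel M) R,
    [/\ W2_geodesic Gamma mu0 mu1,
        {in `[0%R, 1%R], forall s, P2ac m (Gamma s)} &
        {in `[0%R, 1%R], forall s,
          Ent N' (Gamma s) <= (1 - s)%:E * Ent N' mu0 + s%:E * Ent N' mu1}].

End curvature_dimension.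

Section isoperimetry.
Context {R : realType} {M : completeMetricType R}.
Variable m : {measure set (borel M) -> \bar R}.

Definition Gamma_fun (s : R) : R :=
  \int[lebesgue_measure]_(x in `]0, +oo[) (x `^ (s - 1) * expR (- x)).

Definition omega (N : R) : R := pi `^ (N / 2) / Gamma_fun (1 + N / 2).

Definition AVR (N : R) (x : M) : \bar R :=
  lim ((m (ball x r) * ((omega N * r `^ N)^-1)%:E)%E @[r --> +oo%R]).

Definition enlargement (Omega : set M) (e : R) : set M :=
  [set x | exists2 y, Omega y & mdist x y < e].

Definition minkowski_content (Omega : set M) : \bar R :=
  limf_einf
    (fun e : R => m (enlargement Omega e `\` Omega) * (e^-1)%:E)%E 0^'+.

Definition bounded_subset (Omega : set M) :=
  exists (x : M) (r : R), Omega `<=` ball x r.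

Definition isoperimetric_inequality (N : R) (C : \bar R) :=
  forall Omega : set (borel M), measurable Omega -> bounded_subset Omega ->
    (C * m Omega `^ ((N - 1) / N) <= minkowski_content Omega)%E.

End isoperimetry.

(* Main.v *)
Require Import Defs.
From HB Require Import structures.
From mathcomp Require Import all_boot all_order all_algebra.
From mathcomp Require Import all_classical all_reals all_analysis.
From mathcomp Require Import measurable_realfun ring lra.

(** The inequality comes from the Brunn-Minkowski inequality along geodesics
    of measures.  If [A] and [B] have finite positive measure and all distances
    between them are at most [D], then for [0 < s < 1] the convexity of
    [Ent m N] along a geodesic [Gamma] from the uniform measure of [A] to that
    of [B] gives
      [(1 - s) m(A)^(1/N) + s m(B)^(1/N) <= - Ent m N (Gamma s)],
    and [Gamma s] lives on the points at distance at most [s D] from [A], so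
    Jensen's inequality bounds the right-hand side by the [1/N]-th power of
    the measure of any larger enlargement of [A] ([brunn_minkowski]).

    Taking for [A] small balls around a point gives the Bishop-Gromov
    monotonicity of [m(B_r) / r^N] ([bishop_gromov]), the finiteness of the
    measure of balls, and hence the existence of the limit [l] of
    [m(B_r) / r^N], which is [omega N * AVR].  Taking [A = Omega],
    [B = B_r] with [r] large and [s] close to [e / r] gives, as [r] grows,
      [m(Omega_e)^(1/N) >= m(Omega)^(1/N) + l^(1/N) e]  for every [e > 0],
    and Bernoulli's inequality turns this into the lower bound
    [N l^(1/N) m(Omega)^(1 - 1/N)] for every difference quotient of the
    Minkowski content ([minkowski_content_lower_bound]).

    Sharpness is read off balls.  By Bishop-Gromov the Minkowski content of
    [B_r] is at most [N m(B_r) / r], so an admissible constant [C] satisfies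
    [C <= N (m(B_r) / r^N)^(1/N)] for every [r]; now let [r] tend to infinity
    ([isoperimetric_constant_le]).

    The concentration of [Gamma s] near the [s]-intermediate points of [A] and
    [B] is drawn from nearly optimal couplings of [Gamma s] with the two ends.
    They are glued along a countable partition into cells of diameter less
    than [eta] ([partition_coupling]), at the price of an error [eta] in the
    triangle inequality; a quantitative form of the equality case of
      [d^2 <= a^2 / s + b^2 / (1 - s)]  when  [d <= a + b]
    ([intermediate_defect]) then bounds the mass of [Gamma s] that lies too far
    from [A] by a multiple of the errors ([intermediate_mass_le]). *)

Set Implicit Arguments.
Unset Strict Implicit.
Unset Printing Implicit Defensive.

Import Order.TTheory GRing.Theory Num.Theory.
Import numFieldNormedType.Exports.

Local Open Scope classical_set_scope.
Local Open Scope ring_scope.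

(** * Gluing along a countable partition *)

Section partition_coupling.
Local Open Scope ereal_scope.
Context d1 d2 (T1 : measurableType d1) (T2 : measurableType d2) (R : realType).
Variables (P1 : probability T1 R) (P2 : probability T2 R).
Variables (A : (set T1)^nat) (B : (set T2)^nat).
Hypotheses (mA : forall k, measurable (A k)) (mB : forall k, measurable (B k)).
Hypotheses (tA : trivIset setT A) (tB : trivIset setT B).
Hypotheses (UA : \bigcup_k A k = setT) (UB : \bigcup_k B k = setT).
Hypothesis AB : forall k, P1 (A k) = P2 (B k).

Let weight_ge0 k : (0 <= (fine (P1 (A k)))^-1)%R.
Proof. by rewrite invr_ge0 fine_ge0. Qed.

Let cell k : {measure set (T1 * T2)%type -> \bar R} :=
  mscale (NngNum (weight_ge0 k))
    (mrestr (P1 \x P2)%E (measurableX (mA k) (mB k))).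

Let Q : {measure set (T1 * T2)%type -> \bar R} := mseries cell 0.

Let cellE k E F : measurable E -> measurable F ->
  cell k (E `*` F) =
  ((fine (P1 (A k)))^-1)%:E * (P1 (E `&` A k) * P2 (F `&` B k)).
Proof.
move=> mE mF.
rewrite [LHS](_ : _ = ((fine (P1 (A k)))^-1)%:E *
  (P1 \x P2) ((E `*` F) `&` (A k `*` B k)))//.
by rewrite -setXI product_measure1E//; exact: measurableI.
Qed.

(* Cells of mass 0 get weight [0^-1 = 0] and contribute nothing on either
   side. *)
Let Q1 E : measurable E -> Q (E `*` setT) = P1 E.
Proof.
move=> mE; rewrite /Q /= /mseries.
transitivity (\sum_(0 <= k <oo) P1 (E `&` A k)); last first.
  rewrite -measure_semi_bigcup//.
  - by rewrite -setI_bigcupr UA setIT.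
  - by move=> k; exact: measurableI.
  - exact: trivIset_setIl.
  - by apply: bigcupT_measurable => k; exact: measurableI.
apply: eq_eseriesr => k _; rewrite cellE// setTI -AB.
have P1fin X : measurable X -> P1 X \is a fin_num.
  by move=> mX; rewrite fin_num_measure.
have [Ak0|Ak0] := eqVneq (P1 (A k)) 0.
  rewrite Ak0 !mule0; apply/esym/eqP; rewrite eq_le measure_ge0 andbT -Ak0.
  by rewrite le_measure ?inE//; exact: measurableI.
rewrite muleCA -[X in (_ * (_ * X))](fineK (P1fin _ (mA k))) -EFinM.
rewrite mulVf ?mule1//.
by rewrite fine_eq0// P1fin.
Qed.

Let Q2 F : measurable F -> Q (setT `*` F) = P2 F.
Proof.
move=> mF; rewrite /Q /= /mseries.
transitivity (\sum_(0 <= k <oo) P2 (F `&` B k)); last first.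
  rewrite -measure_semi_bigcup//.
  - by rewrite -setI_bigcupr UB setIT.
  - by move=> k; exact: measurableI.
  - exact: trivIset_setIl.
  - by apply: bigcupT_measurable => k; exact: measurableI.
apply: eq_eseriesr => k _; rewrite cellE// setTI AB.
have P2fin X : measurable X -> P2 X \is a fin_num.
  by move=> mX; rewrite fin_num_measure.
have [Ak0|Ak0] := eqVneq (P2 (B k)) 0.
  rewrite Ak0 !mul0e mule0; apply/esym/eqP; rewrite eq_le measure_ge0 andbT -Ak0.
  by rewrite le_measure ?inE//; exact: measurableI.
rewrite muleA -[X in _ * X * _](fineK (P2fin _ (mB k))) -EFinM mulVf ?mul1e//.
by rewrite fine_eq0// P2fin.
Qed.

(** Any two probability measures that charge the cells of two countable
    partitions equally admit a coupling that respects the cells: on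
    [A k `*` B k] take the product measure, renormalized by the common mass of
    the two cells.  With [A k] and [B k] the preimages of the cells of a
    partition of a third space, this is an approximate gluing. *)
Lemma partition_coupling : exists Q : probability (T1 * T2)%type R,
  [/\ forall E, measurable E -> Q (fst @^-1` E) = P1 E,
      forall F, measurable F -> Q (snd @^-1` F) = P2 F &
      Q (~` \bigcup_k (A k `*` B k)) = 0].
Proof.
have QT : Q setT = 1 by rewrite -setXTT Q1// probability_setT.
pose mixin := Measure_isProbability.Build _ _ _ Q QT.
pose Q' : probability (T1 * T2)%type R := HB.pack (Measure.sort Q) mixin.
exists Q'; split=> [E mE|F mF|].
- by rewrite -Q1// setXT.
- by rewrite -Q2// setTX.
rewrite /= /Q /= /mseries eseries0// => k _ _.
rewrite [LHS](_ : _ = ((fine (P1 (A k)))^-1)%:E *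
  (P1 \x P2) (~` (\bigcup_k (A k `*` B k)) `&` (A k `*` B k)))//.
rewrite setIC (_ : _ `&` _ = set0) ?measure0 ?mule0//.
by rewrite -subset0 => x [xk]; apply; exists k.
Qed.

End partition_coupling.
(** * Borel structure of a separable metric space *)

Section metric_borel.
Context {R : realType} {M : completeMetricType R}.
Implicit Types x y z : M.

Lemma open_mball x (r : R) : open (ball x r).
Proof.
rewrite openE => y; rewrite ballEmdist /= => xy.
apply/nbhs_ballP; exists (r - mdist x y) => /=; first by rewrite subr_gt0.
move=> z; rewrite !ballEmdist /= => yz.
by rewrite (le_lt_trans (metric_triangle _ y _))// -ltrBrDl.
Qed.

Lemma measurable_open (U : set M) : open U -> measurable (U : set (borel M)).
Proof. by move=> oU; exact: sub_gen_smallest. Qed.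

Lemma measurable_mball x (r : R) : measurable (ball x r : set (borel M)).
Proof. by apply: measurable_open; exact: open_mball. Qed.

Lemma enlargementE (A : set M) (e : R) :
  enlargement A e = \bigcup_(y in A) ball y e.
Proof.
apply/seteqP; split=> x [y Ay xy]; exists y => //.
  by rewrite ballEmdist /= metric_sym.
by move: xy; rewrite ballEmdist /= metric_sym.
Qed.

Lemma measurable_enlargement (A : set M) (e : R) :
  measurable (enlargement A e : set (borel M)).
Proof.
rewrite enlargementE; apply: measurable_open.
by apply: bigcup_open => y _; apply: open_mball.
Qed.

Lemma dense_sequence : separable M ->
  exists a : nat -> M, forall x (e : R), 0 < e -> exists k, mdist (a k) x < e.
Proof.
case=> D /countable_injP[f finj] dD.
exists (fun k => xget point [set y | D y /\ f y = k]) => x e e0.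
have [|y [xy Dy]] := dD (ball x e) _ (open_mball x e).
  by exists x; exact: ballxx.
exists (f y); case: xgetP => [z _ [Dz fzy]|/(_ y)]; last by case.
have -> : z = y by apply: finj; rewrite ?inE.
by move: xy; rewrite ballEmdist /= metric_sym.
Qed.

(** The product sigma-algebra is generated by rectangles, and separability
    makes each sublevel set of the distance a countable union of products of
    balls: [d x y < r] holds exactly when some point [a k] of a dense sequence
    and some rational [q] satisfy [d x (a k) < q] and [d (a k) y < r - q]. *)
Lemma measurable_mdist : separable M ->
  measurable_fun setT (fun z : borel M * borel M => mdist (z.1 : M) (z.2 : M)).
Proof.
move=> /dense_sequence[a aP].
apply: (measurability _ (RGenInftyO.measurableE R)) => //.
move=> _ [_ [r ->] <-]; rewrite setTI.
pose F k (q : rat) : set (borel M * borel M)%type :=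
  (ball (a k) (ratr q) : set (borel M)) `*`
  (ball (a k) (r - ratr q) : set (borel M)).
rewrite (_ : _ @^-1` _ = \bigcup_k \bigcup_q F k q); last first.
  apply/seteqP; split=> [[x y]|[x y] [k _ [q _ []]]].
    rewrite /= in_itv /= => xy.
    pose e := (r - mdist x y) / 2.
    have e0 : 0 < e by rewrite divr_gt0 ?subr_gt0.
    have [k kx] := aP x e e0.
    have [q] := rat_in_itvoo kx.
    rewrite in_itv /= => /andP[kq qe].
    exists k => //; exists q => //; split; rewrite ballEmdist //=.
    have := metric_triangle (a k) x y; rewrite /e in qe.
    have : mdist (a k) x + mdist x y < ratr q + mdist x y by rewrite ltrD2r.
    by move: qe; lra.
  rewrite !ballEmdist /= in_itv /= => kx ky.
  rewrite (le_lt_trans (metric_triangle _ (a k) _))// metric_sym.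
  by rewrite -(subrKC (ratr q) r) ltrD.
apply: bigcupT_measurable => k; apply: bigcupT_measurable_rat => q.
by apply: measurableX; exact: measurable_mball.
Qed.

Lemma small_partition (eta : R) : separable M -> 0 < eta ->
  exists C : (set (borel M))^nat,
    [/\ forall k, measurable (C k), trivIset setT C, \bigcup_k C k = setT &
        forall k x y, C k x -> C k y -> mdist (x : M) (y : M) < eta].
Proof.
move=> /dense_sequence[a aP] eta0.
pose B k : set (borel M) := ball (a k) (eta / 2).
exists (seqDU B); split=> //.
- by apply: seqDU_measurable => k; exact: measurable_mball.
- rewrite -seqDU_bigcup_eq -subTset => x _.
  have [k kx] := aP x (eta / 2) (divr_gt0 eta0 (ltr0Sn _ _)).
  by exists k => //; rewrite /B ballEmdist.
- move=> k x y Cx Cy.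
  have := subset_seqDU Cx; have := subset_seqDU Cy.
  rewrite /B ballEmdist /= => ky kx.
  rewrite (le_lt_trans (metric_triangle _ (a k) _))// metric_sym.
  by rewrite [ltRHS]splitr ltrD.
Qed.

End metric_borel.
(** * Transport costs *)

Section image_measure.
Local Open Scope ereal_scope.
Context d1 d2 (T1 : measurableType d1) (T2 : measurableType d2) (R : realType).

Lemma image_probability (Q : probability T1 R) (phi : T1 -> T2) :
  measurable_fun setT phi ->
  exists q : probability T2 R, forall E, q E = Q (phi @^-1` E).
Proof.
move=> mphi; pose mixin := isMeasurableFun.Build _ _ _ _ _ mphi.
pose X : {mfun T1 >-> T2} := HB.pack phi mixin.
by exists (distribution Q X).
Qed.

Lemma integral_image (Q : probability T1 R) (q : probability T2 R)
    (phi : T1 -> T2) (g : T2 -> \bar R) :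
  measurable_fun setT phi ->
  (forall E, measurable E -> Q (phi @^-1` E) = q E) ->
  measurable_fun setT g -> (forall x, 0 <= g x) ->
  \int[Q]_z g (phi z) = \int[q]_z g z.
Proof.
move=> mphi Qq mg g0; pose mixin := isMeasurableFun.Build _ _ _ _ _ mphi.
pose X : {mfun T1 >-> T2} := HB.pack phi mixin.
transitivity (\int[distribution Q X]_z g z).
  by rewrite ge0_integral_pushforward.
by apply: eq_measure_integral => A mA _; exact: Qq.
Qed.

End image_measure.

Section wasserstein_intermediate.
Context {R : realType} {M : completeMetricType R}.
Hypothesis sM : separable M.
Implicit Types mu nu lam : probability (borel M) R.
Local Open Scope ereal_scope.

Definition transport_cost (q : probability (borel M * borel M)%type R) :=
  \int[q]_z ((mdist (z.1 : M) (z.2 : M)) ^+ 2)%:E.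

Lemma measurable_sqdist :
  measurable_fun setT (fun z : borel M * borel M =>
    ((mdist (z.1 : M) (z.2 : M)) ^+ 2)%:E).
Proof.
by apply/measurable_EFinP; apply: measurable_funX; exact: measurable_mdist.
Qed.

Lemma transport_cost_ge0 q : 0 <= transport_cost q.
Proof. by apply: integral_ge0 => z _; rewrite lee_fin sqr_ge0. Qed.

Lemma W2_sqr mu nu :
  W2 mu nu `^ 2 = ereal_inf [set transport_cost q | q in coupling mu nu].
Proof.
rewrite /W2 -poweRrM mulVf// poweRe1//.
by apply: le_ereal_inf_tmp => _ [q _ <-]; exact: transport_cost_ge0.
Qed.

Lemma W2_sqr_le mu nu q : coupling mu nu q -> W2 mu nu `^ 2 <= transport_cost q.
Proof. by move=> cq; rewrite W2_sqr; apply: ereal_inf_lbound; exists q. Qed.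

Lemma near_optimal_coupling mu nu (w : R) : W2 mu nu `^ 2 < w%:E ->
  exists2 q, coupling mu nu q & transport_cost q < w%:E.
Proof. by rewrite W2_sqr => /ereal_inf_lt[_ [q cq <-] qw]; exists q. Qed.

(** The coupling [Q] describes quadruples [((x, y), (y', z))] where [(x, y)]
    follows [q1], [(y', z)] follows [q2] and [y'] is [eta]-close to [y]: an
    approximate form of the gluing lemma, where [y' = y]. *)
Lemma glue_couplings mu nu lam q1 q2 (eta : R) : (0 < eta)%R ->
  coupling mu nu q1 -> coupling nu lam q2 ->
  exists Q : probability ((borel M * borel M) * (borel M * borel M))%type R,
    [/\ forall E, measurable E -> Q (fst @^-1` E) = q1 E,
        forall E, measurable E -> Q (snd @^-1` E) = q2 E &
        {ae Q, forall z, (mdist (z.1.2 : M) (z.2.1 : M) < eta)%R}].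
Proof.
move=> eta0 c1 c2; have [C [mC tC UC Ceta]] := small_partition sM eta0.
have mA k : measurable (snd @^-1` C k : set (borel M * borel M)).
  by rewrite -[X in measurable X]setTI; exact: measurable_snd.
have mB k : measurable (fst @^-1` C k : set (borel M * borel M)).
  by rewrite -[X in measurable X]setTI; exact: measurable_fst.
have [||||k|Q [Q1 Q2 Q0]] := @partition_coupling _ _ _ _ R q1 q2 _ _ mA mB.
- by move=> i j _ _ [z [zi zj]]; apply: tC => //; exists z.2.
- by move=> i j _ _ [z [zi zj]]; apply: tC => //; exists z.1.
- by rewrite -preimage_bigcup UC.
- by rewrite -preimage_bigcup UC.
- by rewrite [LHS](c1 _ (mC k)).2 [RHS](c2 _ (mC k)).1.
exists Q; split=> //.
exists (~` \bigcup_k ((snd @^-1` C k) `*` (fst @^-1` C k))); split=> //.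
  apply: measurableC; apply: bigcupT_measurable => k.
  exact: measurableX.
move=> z /= zeta [k _ [zk1 zk2]]; apply: zeta; exact: Ceta zk1 zk2.
Qed.

End wasserstein_intermediate.
(** * Concentration of geodesics near intermediate points *)

(** With [u = a - s d] and [v = b - (1 - s) d] one has
    [a^2 / s + b^2 / (1 - s) - d^2 = 2 d (u + v) + u^2 / s + v^2 / (1 - s)],
    and [u + v >= - eta]. The term [u^2 / s] measures how far [a] is from the
    value [s d] that it takes on a geodesic. *)
Lemma intermediate_defect {R : realFieldType} (s d a b eta D : R) :
  0 < s < 1 -> 0 <= d <= D -> 0 <= eta -> d <= a + b + eta ->
  d ^+ 2 + (a - s * d) ^+ 2 / s <= a ^+ 2 / s + b ^+ 2 / (1 - s) + 2 * D * eta.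
Proof.
move=> /andP[s0 s1] /andP[d0 dD] eta0 dab.
have s1' : 0 < 1 - s by rewrite subr_gt0.
pose v := b - (1 - s) * d.
have -> : a ^+ 2 / s + b ^+ 2 / (1 - s) + 2 * D * eta =
    d ^+ 2 + (a - s * d) ^+ 2 / s + v ^+ 2 / (1 - s) +
    2 * (d * (a + b + eta - d) + (D - d) * eta).
  by rewrite /v; field; rewrite !gt_eqF.
have v0 : 0 <= v ^+ 2 / (1 - s) by rewrite divr_ge0 ?sqr_ge0// ltW.
have h1 : 0 <= d * (a + b + eta - d) by rewrite mulr_ge0 ?subr_ge0.
have h2 : 0 <= (D - d) * eta by rewrite mulr_ge0 ?subr_ge0.
by lra.
Qed.

Section intermediate_measures.
Context {R : realType} {M : completeMetricType R}.
Hypothesis sM : separable M.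
Implicit Types mu nu lam : probability (borel M) R.
Local Open Scope ereal_scope.

Let ae_image d1 d2 (T1 : measurableType d1) (T2 : measurableType d2)
    (Q : probability T1 R) (phi : T1 -> T2) (A : set T2) :
  measurable_fun setT phi -> measurable A -> Q (phi @^-1` (~` A)) = 0 ->
  {ae Q, forall z, A (phi z)}.
Proof.
move=> mphi mA Q0; exists (phi @^-1` (~` A)); split=> //.
by rewrite -[X in measurable X]setTI; apply: mphi => //; exact: measurableC.
Qed.

(** Compare the cost [w] of [mu] and [lam] with that of the ends [(x, z)] of a
    glued quadruple. On the event that [y] lies outside the enlargement,
    [d(x, y) - s d(x, z) >= theta], so the defect inequality costs
    [theta^2 / s]; elsewhere it loses at most [2 D e]. The costs of [q1] and
    [q2], weighted by [1/s] and [1/(1 - s)], add up to [w] up to the errors. *)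
Lemma intermediate_mass_le mu nu lam (A B : set (borel M)) (s D w theta e : R) :
  (0 < s < 1)%R -> (0 <= D)%R -> (0 < theta)%R -> (0 < e)%R ->
  measurable A -> measurable B -> mu (~` A) = 0 -> lam (~` B) = 0 ->
  (forall x y, A x -> B y -> (mdist (x : M) (y : M) <= D)%R) ->
  W2 mu lam `^ 2 = w%:E ->
  W2 mu nu `^ 2 = (s ^+ 2 * w)%:E -> W2 nu lam `^ 2 = ((1 - s) ^+ 2 * w)%:E ->
  (theta ^+ 2 / s)%:E * nu (~` enlargement A (s * D + theta)) <=
  (e / s + e / (1 - s) + 2 * D * e)%:E.
Proof.
move=> s01 D0 theta0 e0 mA mB muA lamB AB Wml Wmn Wnl.
have /andP[s0 s1] := s01; have s1' : (0 < 1 - s)%R by rewrite subr_gt0.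
have [q1 c1 q1e] : exists2 q, coupling mu nu q &
    transport_cost q < (s ^+ 2 * w + e)%:E.
  by apply: near_optimal_coupling; rewrite Wmn lte_fin ltrDl.
have [q2 c2 q2e] : exists2 q, coupling nu lam q &
    transport_cost q < ((1 - s) ^+ 2 * w + e)%:E.
  by apply: near_optimal_coupling; rewrite Wnl lte_fin ltrDl.
have [Q [Q1 Q2 Qe]] := glue_couplings sM e0 c1 c2.
set F := ~` enlargement A (s * D + theta).
have mF : measurable (F : set (borel M)).
  by apply: measurableC; exact: measurable_enlargement.
pose T := ((borel M * borel M) * (borel M * borel M))%type.
have m11 : measurable_fun setT (fun z : T => z.1.1).
  exact: (measurableT_comp measurable_fst measurable_fst).
have m12 : measurable_fun setT (fun z : T => z.1.2).
  exact: (measurableT_comp measurable_snd measurable_fst).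
have m22 : measurable_fun setT (fun z : T => z.2.2).
  exact: (measurableT_comp measurable_snd measurable_snd).
have mends : measurable_fun setT (fun z : T => (z.1.1, z.2.2)).
  exact: measurable_fun_pair.
have [q qE] := image_probability Q mends.
have Q11 E : measurable E -> Q (fun z : T => E z.1.1) = mu E.
  move=> mE; rewrite -(c1 E mE).1 -[RHS]Q1//.
  by rewrite -[X in measurable X]setTI; exact: measurable_fst.
have Q12 E : measurable E -> Q (fun z : T => E z.1.2) = nu E.
  move=> mE; rewrite -(c1 E mE).2 -[RHS]Q1//.
  by rewrite -[X in measurable X]setTI; exact: measurable_snd.
have Q22 E : measurable E -> Q (fun z : T => E z.2.2) = lam E.
  move=> mE; rewrite -(c2 E mE).2 -[RHS]Q2//.
  by rewrite -[X in measurable X]setTI; exact: measurable_snd.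
have cq : coupling mu lam q.
  by move=> E mE; rewrite /pushforward !qE -(Q11 _ mE) -(Q22 _ mE).
have AQ : {ae Q, forall z : T, A z.1.1}.
  by apply: ae_image => //; rewrite [LHS]Q11//; exact: measurableC.
have BQ : {ae Q, forall z : T, B z.2.2}.
  by apply: ae_image => //; rewrite [LHS]Q22//; exact: measurableC.
pose c (z : borel M * borel M) := ((mdist (z.1 : M) (z.2 : M)) ^+ 2)%:E.
have mc : measurable_fun setT c by exact: measurable_sqdist.
have c0 z : 0 <= c z by rewrite lee_fin sqr_ge0.
pose f (z : T) : \bar R :=
  c (z.1.1, z.2.2) + (theta ^+ 2 / s)%:E * (\1_F z.1.2)%:E.
pose g (z : T) : \bar R :=
  (s^-1)%:E * c z.1 + ((1 - s)^-1)%:E * c z.2 + (2 * D * e)%:E.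
have fg : {ae Q, forall z, setT z -> f z <= g z}.
  apply: filterS3 AQ BQ Qe => -[[x y] [y' z]] /= Ax Bz yy' _.
  rewrite /f /g /c /= -!EFinM -!EFinD lee_fin.
  have dxz : (mdist (x : M) z <= mdist (x : M) y + mdist (y' : M) z + e)%R.
    apply: (le_trans (metric_triangle x y z)).
    rewrite -addrA lerD2l addrC.
    by rewrite (le_trans (metric_triangle y y' z))// lerD2r ltW.
  have d0D : (0 <= mdist (x : M) z <= D)%R by rewrite mdist_ge0 AB.
  have := intermediate_defect s01 d0D (ltW e0) dxz.
  rewrite ![(_^-1 * _)%R]mulrC; apply: le_trans.
  rewrite lerD2l indicE mulrAC ler_pM2r ?invr_gt0//.
  have [/set_mem Fy|_] := boolP (y \in F); last by rewrite mulr0 sqr_ge0.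
  have far : (s * D + theta <= mdist (x : M) y)%R.
    by rewrite leNgt; apply/negP => xy; apply: Fy; exists x; rewrite 1?metric_sym.
  have sd : (s * mdist (x : M) z <= s * D)%R by rewrite ler_pM2l// (andP d0D).2.
  rewrite mulr1 ler_sqr ?nnegrE ?(ltW theta0)//; lra.
have D0' : (0 <= 2 * D * e)%R by rewrite !mulr_ge0// ltW.
have mF1 : measurable_fun setT (fun z : T => (\1_F z.1.2)%:E : \bar R).
  by apply/measurable_EFinP; exact: measurableT_comp.
have mc1 : measurable_fun setT (fun z : T => c z.1).
  by apply: (measurableT_comp mc); exact: measurable_fst.
have mc2 : measurable_fun setT (fun z : T => c z.2).
  by apply: (measurableT_comp mc); exact: measurable_snd.
have mcx : measurable_fun setT (fun z : T => c (z.1.1, z.2.2)).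
  exact: (measurableT_comp mc).
have th0 : (0 <= theta ^+ 2 / s)%R by rewrite divr_ge0 ?sqr_ge0// ltW.
have mf : measurable_fun setT f.
  by apply: emeasurable_funD => //; exact: emeasurable_funM.
have mg1 : measurable_fun setT (fun z : T => (s^-1)%:E * c z.1).
  exact: emeasurable_funM.
have mg2 : measurable_fun setT (fun z : T => ((1 - s)^-1)%:E * c z.2).
  exact: emeasurable_funM.
have mg12 : measurable_fun setT
    (fun z : T => (s^-1)%:E * c z.1 + ((1 - s)^-1)%:E * c z.2).
  exact: emeasurable_funD.
have mg : measurable_fun setT g by exact: emeasurable_funD.
have f0 z : 0 <= f z.
  by apply: adde_ge0; [exact: c0|apply: mule_ge0; rewrite lee_fin].
have s0i : (0 <= s^-1)%R by rewrite invr_ge0 ltW.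
have s1i : (0 <= (1 - s)^-1)%R by rewrite invr_ge0 ltW.
have g0 z : 0 <= g z.
  by rewrite /g !adde_ge0 ?mule_ge0 ?c0 ?lee_fin.
have If : \int[Q]_z f z = transport_cost q + (theta ^+ 2 / s)%:E * nu F.
  rewrite ge0_integralD//; first last.
  - exact: emeasurable_funM.
  - by move=> z _; rewrite mule_ge0 ?lee_fin.
  congr (_ + _).
    exact: (@integral_image _ _ _ _ _ Q q _ c mends).
  rewrite ge0_integralZl ?lee_fin//; congr (_ * _).
  rewrite -(Q12 _ mF).
  transitivity (\int[Q]_z (\1_(fun z : T => F z.1.2) z)%:E).
    by apply: eq_integral => z _; rewrite !indicE.
  by rewrite integral_indic ?setIT// -[X in measurable X]setTI; exact: m12.
have Icst : \int[Q]__ (2 * D * e)%:E = (2 * D * e)%:E.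
  by rewrite integral_cst// -[RHS]mule1; congr (_ * _); exact: probability_setT.
have Ig : \int[Q]_z g z = (s^-1)%:E * transport_cost q1 +
    ((1 - s)^-1)%:E * transport_cost q2 + (2 * D * e)%:E.
  rewrite ge0_integralD//; first last.
  - by move=> z _; rewrite adde_ge0 ?mule_ge0 ?c0 ?lee_fin.
  rewrite ge0_integralD//; first last.
  - by move=> z _; rewrite mule_ge0 ?c0 ?lee_fin.
  - by move=> z _; rewrite mule_ge0 ?c0 ?lee_fin.
  rewrite !ge0_integralZl ?lee_fin// Icst.
  congr (_ * _ + _ * _ + _).
    exact: (@integral_image _ _ _ _ _ Q q1 _ c measurable_fst).
  exact: (@integral_image _ _ _ _ _ Q q2 _ c measurable_snd).
have := ae_ge0_le_integral measurableT
  (fun z _ => f0 z) mf (fun z _ => g0 z) mg fg.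
rewrite If Ig => le_fg.
have wq : w%:E <= transport_cost q by rewrite -Wml; exact: W2_sqr_le.
have : w%:E + (theta ^+ 2 / s)%:E * nu F <= (s^-1)%:E * (s ^+ 2 * w + e)%:E +
    ((1 - s)^-1)%:E * ((1 - s) ^+ 2 * w + e)%:E + (2 * D * e)%:E.
  rewrite (le_trans (leeD2r _ wq))// (le_trans le_fg)// leeD2r// leeD//.
    by rewrite lee_wpmul2l ?lee_fin// ltW.
  by rewrite lee_wpmul2l ?lee_fin// ltW.
have nuF : nu F \is a fin_num by rewrite fin_num_measure.
rewrite -(fineK nuF) -!EFinM -!EFinD !lee_fin.
set X := (_ * fine _)%R => hX.
rewrite -(lerD2l w); apply: (le_trans hX); rewrite le_eqVlt; apply/orP; left.
by apply/eqP; field; rewrite !gt_eqF.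
Qed.

End intermediate_measures.
Section geodesic_concentration.
Context {R : realType} {M : completeMetricType R}.
Hypothesis sM : separable M.
Implicit Types mu nu lam : probability (borel M) R.
Local Open Scope ereal_scope.

Lemma eq_W2 mu mu' nu nu' :
  (forall A : set (borel M), measurable A -> mu A = mu' A) ->
  (forall A : set (borel M), measurable A -> nu A = nu' A) ->
  W2 mu nu = W2 mu' nu'.
Proof.
move=> mumu' nunu'; rewrite /W2; congr (ereal_inf (image _ _) `^ _).
apply/funext => q; apply/propext; split=> cq E mE.
  by rewrite -mumu'// -nunu'//; exact: cq.
by rewrite mumu'// nunu'//; exact: cq.
Qed.

(** The product coupling already has cost at most [D^2], so the distance is
    finite and can be used in real arithmetic. *)
Lemma W2_bounded_support mu lam (A B : set (borel M)) (D : R) :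
  (0 <= D)%R -> measurable A -> measurable B ->
  mu (~` A) = 0 -> lam (~` B) = 0 ->
  (forall x y, A x -> B y -> (mdist (x : M) (y : M) <= D)%R) ->
  W2 mu lam `^ 2 <= (D ^+ 2)%:E.
Proof.
move=> D0 mA mB muA lamB AB.
have qT : (mu \x lam) setT = 1.
  rewrite -setXTT; transitivity (mu setT * lam setT).
    exact: product_measure1E.
  by rewrite !probability_setT mule1.
pose mixin := Measure_isProbability.Build _ _ _ (mu \x lam)%E qT.
pose q : probability (borel M * borel M)%type R := HB.pack (mu \x lam)%E mixin.
have qfst E : measurable E -> q (fst @^-1` E) = mu E.
  move=> mE; rewrite -setXT; transitivity (mu E * lam setT).
    exact: product_measure1E.
  by rewrite probability_setT mule1.
have qsnd E : measurable E -> q (snd @^-1` E) = lam E.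
  move=> mE; rewrite -setTX; transitivity (mu setT * lam E).
    exact: product_measure1E.
  by rewrite probability_setT mul1e.
have cq : coupling mu lam q by move=> E mE; split; [exact: qfst|exact: qsnd].
apply: (le_trans (W2_sqr_le cq)).
rewrite (_ : (D ^+ 2)%:E = \int[q]__ (D ^+ 2)%:E); last first.
  rewrite integral_cst// -[LHS]mule1; congr (_ * _).
  by apply/esym; exact: probability_setT.
apply: ae_ge0_le_integral => //.
- by move=> z _; rewrite lee_fin sqr_ge0.
- exact: measurable_sqdist.
- by move=> z _; rewrite lee_fin sqr_ge0.
have AQ : {ae q, forall z, A z.1}.
  exists (fst @^-1` (~` A)); split=> //.
    rewrite -[X in measurable X]setTI; apply: measurable_fst => //.
    exact: measurableC.
  by rewrite qfst//; exact: measurableC.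
have BQ : {ae q, forall z, B z.2}.
  exists (snd @^-1` (~` B)); split=> //.
    rewrite -[X in measurable X]setTI; apply: measurable_snd => //.
    exact: measurableC.
  by rewrite qsnd//; exact: measurableC.
apply: filterS2 AQ BQ => z Az Bz _.
by rewrite lee_fin ler_sqr ?nnegrE ?mdist_ge0// AB.
Qed.

(** All the points that a geodesic charges at time [s] are at distance at most
    [s D] from the support of its origin; the margin [theta] makes the
    exceptional set Borel and pays for the approximations. *)
Lemma geodesic_concentrated Gamma mu lam (A B : set (borel M)) (s D theta : R) :
  W2_geodesic Gamma mu lam -> (0 < s < 1)%R -> (0 <= D)%R -> (0 < theta)%R ->
  measurable A -> measurable B -> mu (~` A) = 0 -> lam (~` B) = 0 ->
  (forall x y, A x -> B y -> (mdist (x : M) (y : M) <= D)%R) ->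
  Gamma s (~` enlargement A (s * D + theta)) = 0.
Proof.
move=> [G0 G1 Gst] s01 D0 theta0 mA mB muA lamB AB.
have /andP[s0 s1] := s01.
set nu := Gamma s; set F := ~` _.
have s1' : (0 < 1 - s)%R by rewrite subr_gt0.
have sin : s \in `[0%R, 1%R] by rewrite in_itv /= !ltW.
have W2mn : W2 mu nu = s%:E * W2 mu lam.
  rewrite -(@eq_W2 (Gamma 0%R) mu nu nu)// Gst ?sub0r ?normrN ?gtr0_norm//.
  by rewrite in_itv /= lexx ler01.
have W2nl : W2 nu lam = (1 - s)%:E * W2 mu lam.
  rewrite -(@eq_W2 nu nu (Gamma 1%R) lam)// Gst// 1?distrC ?gtr0_norm//.
  by rewrite in_itv /= lexx ler01.
have Wle := W2_bounded_support D0 mA mB muA lamB AB.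
have Wfin : W2 mu lam `^ 2 \is a fin_num.
  by rewrite ge0_fin_numE ?poweR_ge0// (le_lt_trans Wle) ?ltry.
pose w := fine (W2 mu lam `^ 2).
have Ww : W2 mu lam `^ 2 = w%:E by rewrite fineK.
have W20 : 0 <= W2 mu lam by exact: poweR_ge0.
have sqr_scale t : (0 < t)%R -> (t%:E * W2 mu lam) `^ 2 = (t ^+ 2 * w)%:E.
  move=> t0; rewrite poweRM//; last by rewrite lee_fin ltW.
  by rewrite Ww poweR_EFin powR_mulrn ?ltW.
have Wmn : W2 mu nu `^ 2 = (s ^+ 2 * w)%:E by rewrite W2mn sqr_scale.
have Wnl : W2 nu lam `^ 2 = ((1 - s) ^+ 2 * w)%:E by rewrite W2nl sqr_scale.
have mass_le e e0 := intermediate_mass_le sM s01 D0 theta0 e0 mA mB muA lamB AB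
  Ww Wmn Wnl : _ <= (e / s + e / (1 - s) + 2 * D * e)%:E.
have mF : measurable (F : set (borel M)).
  by apply: measurableC; exact: measurable_enlargement.
have nuF : nu F \is a fin_num by rewrite fin_num_measure.
apply/eqP; rewrite eq_le measure_ge0 andbT -(fineK nuF) lee_fin.
apply/ler_addgt0Pl => d d0; rewrite addr0.
pose K := (s^-1 + (1 - s)^-1 + 2 * D)%R.
have K0 : (0 < K)%R.
  by rewrite ltr_pwDl ?mulr_ge0// addr_gt0 ?invr_gt0.
have t0 : (0 < theta ^+ 2 / s)%R by rewrite divr_gt0 ?exprn_gt0.
(* This error makes the bound of [intermediate_mass_le] equal to
   [theta ^+ 2 / s * d]. *)
have e0 : (0 < d * (theta ^+ 2 / s) / K)%R by rewrite !mulr_gt0 ?invr_gt0.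
have := mass_le _ e0; rewrite -(fineK nuF) -EFinM lee_fin => h.
rewrite -(ler_pM2l t0); apply: (le_trans h); rewrite le_eqVlt; apply/orP; left.
set e := (d * _ / K)%R.
have -> : (e / s + e / (1 - s) + 2 * D * e)%R = (e * K)%R.
  by rewrite /K; ring.
by rewrite /e divfK ?(gt_eqF K0)// mulrC.
Qed.

End geodesic_concentration.
(** * Bernoulli and Jensen inequalities for real powers *)

Section bernoulli.
Context {R : realType}.
Implicit Types p t u N : R.

(** Young's inequality for [t `^ p * 1]. *)
Lemma powR_le_tangent p t : 0 < p < 1 -> 0 <= t -> t `^ p <= p * t + (1 - p).
Proof.
move=> /andP[p0 p1] t0; have p1' : 0 < 1 - p by rewrite subr_gt0.
have := @conjugate_powR R (t `^ p) 1 p^-1 (1 - p)^-1 (powR_ge0 _ _) ler01.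
rewrite !invr_gt0 !invrK => /(_ p0 p1' (subrKC _ _)).
by rewrite mulr1 -powRrM mulfV ?gt_eqF// powRr1// powR1 mul1r mulrC.
Qed.

(** The tangent bound for the concave power [N^-1] at [1 + N * u], raised to
    the power [N]. *)
Lemma bernoulli_powR N u : 1 < N -> 0 <= 1 + N * u -> 1 + N * u <= (1 + u) `^ N.
Proof.
move=> N1 Nu; have N0 : 0 < N by rewrite (lt_trans ltr01).
have N01 : 0 < N^-1 < 1 by rewrite invr_gt0 N0 invf_lt1.
have root_le : (1 + N * u) `^ N^-1 <= 1 + u.
  apply: (le_trans (powR_le_tangent N01 Nu)).
  by rewrite mulrDr mulKf ?gt_eqF// mulr1 addrAC subrKC.
have := ge0_ler_powR (ltW N0) _ _ root_le.
rewrite -powRrM mulVf ?gt_eqF// powRr1//; apply; rewrite nnegrE ?powR_ge0//.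
exact: le_trans (powR_ge0 _ _) root_le.
Qed.

End bernoulli.

Section integral_powR.
Local Open Scope ereal_scope.
Context d (T : measurableType d) (R : realType).
Variable m : {measure set T -> \bar R}.

(** Jensen's inequality for the concave power [p] on [E], proved by integrating
    the tangent bound at [c * rho], where [c = m E]; off [E] the density
    vanishes almost everywhere. *)
Lemma integral_powR_le (rho : T -> R) (p : R) (E : set T) : (0 < p < 1)%R ->
  measurable_fun setT rho -> (forall x, (0 <= rho x)%R) -> measurable E ->
  \int[m]_(x in E) (rho x)%:E <= 1 -> \int[m]_(x in ~` E) (rho x)%:E = 0 ->
  \int[m]_x (rho x `^ p)%:E <= m E `^ (1 - p).
Proof.
move=> p01 mrho rho0 mE rhoE rhoCE.
have /andP[p0 p1] := p01.
have mrhop : measurable_fun setT (fun x => (rho x `^ p)%:E).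
  by apply/measurable_EFinP; exact: (measurableT_comp (measurable_powR p) mrho).
have mrhoE : measurable_fun setT (fun x => (rho x)%:E) by exact/measurable_EFinP.
have rhop0 x : 0 <= (rho x `^ p)%:E by rewrite lee_fin powR_ge0.
have CE0 : \int[m]_(x in ~` E) (rho x `^ p)%:E = 0.
  have mCE : measurable (~` E) by exact: measurableC.
  have /ae_eq_integral_abs : \int[m]_(x in ~` E) `|(rho x)%:E| = 0.
    by under eq_integral => x _ do rewrite gee0_abs ?lee_fin//.
  move=> /(_ mCE (measurable_funTS mrhoE)) rho_ae.
  rewrite (@ge0_ae_eq_integral _ _ _ m _ _ (cst 0))//.
  - by rewrite integral0.
  - exact: measurable_funTS.
  - apply: filterS rho_ae => x /= h /h [->].
    by rewrite powR0// gt_eqF.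
rewrite -(setUv E) ge0_integral_setU ?setUv//; first last.
- by apply/disj_setPS; rewrite setICr.
- exact: measurableC.
rewrite CE0 adde0.
have [mEy|mEy] := eqVneq (m E) +oo.
  by rewrite mEy poweRyr ?leey// subr_eq0 gt_eqF.
have mEfin : m E \is a fin_num by rewrite ge0_fin_numE// ltey.
have [mE0|mE0] := eqVneq (m E) 0.
  by rewrite mE0 null_set_integral// ?poweR_ge0//; exact: measurable_funTS.
pose c := fine (m E).
have mEc : m E = c%:E by rewrite fineK.
have c0 : (0 < c)%R by rewrite fine_gt0// lt0e mE0 measure_ge0 ltey.
rewrite mEc poweR_EFin.
rewrite (_ : c `^ (1 - p) = (c `^ p)^-1 * c)%R; last first.
  by rewrite powRB ?gt_eqF// powRr1 ?ltW// mulrC.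
rewrite EFinM lee_pdivlMl ?powR_gt0//.
rewrite -ge0_integralZl//; last 2 first.
- exact: measurable_funTS.
- by rewrite lee_fin powR_ge0.
apply: (@le_trans _ _ (\int[m]_(x in E) ((p * c)%:E * (rho x)%:E + (1 - p)%:E))).
  apply: ge0_le_integral => //.
  - by move=> x _; rewrite mule_ge0 ?lee_fin ?powR_ge0.
  - by apply: emeasurable_funM => //; exact: measurable_funTS.
  - apply: emeasurable_funD => //; apply: emeasurable_funM => //.
    by exact: measurable_funTS.
  move=> x _; rewrite -!EFinM -EFinD lee_fin -powRM ?(ltW c0)// -mulrA.
  by rewrite powR_le_tangent// mulr_ge0// ltW.
rewrite ge0_integralD//; last 3 first.
- by move=> x _; rewrite mule_ge0 ?lee_fin ?mulr_ge0// ltW.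
- by apply: emeasurable_funM => //; exact: measurable_funTS.
- by move=> x _; rewrite lee_fin subr_ge0 ltW.
rewrite ge0_integralZl//; last 3 first.
- exact: measurable_funTS.
- by move=> x _; rewrite lee_fin.
- by rewrite lee_fin mulr_ge0// ltW.
rewrite integral_cst// mEc -EFinM.
apply: (@le_trans _ _ ((p * c)%:E * 1 + ((1 - p) * c)%:E)).
  by rewrite leeD2r// lee_wpmul2l// lee_fin mulr_ge0// ltW.
by rewrite mule1 -EFinD lee_fin -mulrDl subrKC mul1r.
Qed.

End integral_powR.
(** * Entropy and the Brunn-Minkowski inequality *)

Section entropy.
Context {R : realType} {M : completeMetricType R}.
Variable m : {measure set (borel M) -> \bar R}.
Implicit Types mu nu : probability (borel M) R.
Local Open Scope ereal_scope.

Lemma uniform_probability (A : set (borel M)) :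
  measurable A -> 0 < m A -> m A < +oo ->
  exists mu, forall E, mu E = ((fine (m A))^-1)%:E * m (E `&` A).
Proof.
move=> mA A0 Ay.
have w0 : (0 <= (fine (m A))^-1)%R by rewrite invr_ge0 fine_ge0.
pose u := mscale (NngNum w0) (mrestr m mA).
have uE E : u E = ((fine (m A))^-1)%:E * m (E `&` A) by [].
have uT : u setT = 1.
  rewrite uE setTI -[X in _ * X]fineK ?ge0_fin_numE// -EFinM mulVf//.
  by rewrite gt_eqF// fine_gt0// A0.
pose mixin := Measure_isProbability.Build _ _ _ u uT.
pose mu : probability (borel M) R := HB.pack u mixin.
by exists mu.
Qed.

(** Jensen's inequality uses of the density only that it integrates to at most
    1 over [E] and to 0 over [~` E]. Both hold for any Lebesgue decomposition
    of [nu], and also for the default value [cst 0] of [ac_density]. *)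
Lemma Ent_ge N nu (E : set (borel M)) : (1 < N)%R -> measurable E ->
  nu (~` E) = 0 -> - (m E `^ N^-1) <= Ent m N nu.
Proof.
move=> N1 mE nuE; rewrite /Ent leeN2.
have N0 : (0 < N)%R by rewrite (lt_trans ltr01).
have p01 : (0 < 1 - N^-1 < 1)%R.
  by rewrite subr_gt0 invf_lt1// N1 ltrBlDl ltrDr invr_gt0.
suff [mrho rho0 rhoE rhoCE] : [/\ measurable_fun setT (ac_density m nu),
    forall x, (0 <= ac_density m nu x)%R,
    \int[m]_(x in E) (ac_density m nu x)%:E <= 1 &
    \int[m]_(x in ~` E) (ac_density m nu x)%:E = 0].
  by rewrite -[X in m E `^ X](subKr 1); exact: integral_powR_le.
rewrite /ac_density; case: xgetP => [rho _ [mus [mrho rho0 _ rhoE]]|_]; last first.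
  by split=> //; rewrite ?integral0// lee_fin.
have int_le F : measurable F -> \int[m]_(x in F) (rho x)%:E <= nu F.
  by move=> mF; rewrite rhoE// leeDl.
split=> //.
  by rewrite (le_trans (int_le _ mE))// probability_le1.
apply/eqP; rewrite eq_le -nuE int_le /=; last exact: measurableC.
by rewrite nuE integral_ge0// => x _; rewrite lee_fin.
Qed.

(** The density chosen by [ac_density] is unknown, but the explicit density
    [\1_A / m A] shows that one exists; the singular part of any decomposition
    vanishes because [mu] has a density, and densities are unique almost
    everywhere. *)
Lemma Ent_uniform N mu (A : set (borel M)) : (1 < N)%R ->
  measurable A -> 0 < m A -> m A < +oo ->
  (forall E, measurable E -> mu E = ((fine (m A))^-1)%:E * m (E `&` A)) ->
  Ent m N mu = - (m A `^ N^-1).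
Proof.
move=> N1 mA A0 Ay muE; rewrite /Ent; congr (- _).
have N0 : (0 < N)%R by rewrite (lt_trans ltr01).
pose c := fine (m A).
have mAc : m A = c%:E by rewrite fineK// ge0_fin_numE.
have c0 : (0 < c)%R by rewrite fine_gt0// A0.
pose rho0 (x : borel M) : R := (c^-1 * \1_A x)%R.
have mrho0 : measurable_fun setT rho0.
  by apply: measurable_funM => //; exact: measurable_indic.
have rho00 x : (0 <= rho0 x)%R by rewrite mulr_ge0// invr_ge0 ltW.
have m1A : measurable_fun setT (fun x : borel M => (\1_A x)%:E : \bar R).
  by apply/measurable_EFinP; exact: measurable_indic.
have int_rho0 E : measurable E -> \int[m]_(x in E) (rho0 x)%:E = mu E.
  move=> mE; under eq_integral do rewrite EFinM.
  rewrite ge0_integralZl//; last 2 first.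
  - exact: measurable_funTS.
  - by rewrite lee_fin invr_ge0 ltW.
  by rewrite integral_indic// muE// setIC.
have ae_rho : ae_eq m setT (EFin \o rho0) (EFin \o ac_density m mu) /\
    measurable_fun setT (ac_density m mu).
  rewrite /ac_density; case: xgetP => [rho _ [mus [mrho rhop sing rhoE]]|none];
      last first.
    exfalso; apply: (none rho0); exists mzero; split=> //.
      by exists setT; split=> //; rewrite setCT measure0.
    by move=> E mE; rewrite int_rho0// -[LHS]adde0.
  split=> //; apply: integral_ae_eq => //.
  - apply/integrableP; split; first by apply/measurable_EFinP.
    under eq_integral => x _ do rewrite gee0_abs ?lee_fin//.
    by rewrite int_rho0// probability_setT ltry.
  - by apply/measurable_EFinP.
  move=> E _ mE; rewrite int_rho0// rhoE//.
  case: sing => S [mS mus0 mSC].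
  have mCS := measurableC mS.
  have muSC : mu (~` S) = 0.
    rewrite muE// (_ : m (_ `&` _) = 0) ?mule0//; apply/eqP.
    by rewrite eq_le measure_ge0 andbT -mSC le_measure ?inE//; exact: measurableI.
  have musC : mus (~` S) = 0.
    apply/eqP; rewrite eq_le measure_ge0 andbT -muSC rhoE// leeDr//.
    by apply: integral_ge0 => x _; rewrite lee_fin.
  rewrite (_ : mus E = 0) ?adde0//; apply/eqP; rewrite eq_le measure_ge0 andbT.
  rewrite -(setIT E) -(setUv S) setIUr (le_trans (measureU2 _ _ _))//.
  - exact: measurableI.
  - exact: measurableI.
  rewrite -(adde0 0) leeD//.
    by rewrite -mus0 le_measure ?inE//; exact: measurableI.
  by rewrite -musC le_measure ?inE//; exact: measurableI.
case: ae_rho => ae_rho mrho.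
have N01 : (0 < 1 - N^-1)%R by rewrite subr_gt0 invf_lt1.
have mpow f : measurable_fun setT f ->
    measurable_fun setT (fun x : borel M => (f x `^ (1 - N^-1))%:E).
  move=> mf; apply/measurable_EFinP.
  exact: (measurableT_comp (measurable_powR _) mf).
transitivity (\int[m]_x ((c^-1 `^ (1 - N^-1))%:E * (\1_A x)%:E)).
  apply: ge0_ae_eq_integral => //.
  - exact: mpow.
  - exact: emeasurable_funM.
  - by move=> x _; rewrite lee_fin powR_ge0.
  - by move=> x _; rewrite mule_ge0 ?lee_fin// powR_ge0.
  apply: filterS ae_rho => x /(_ Logic.I) /= [<-] _.
  rewrite -EFinM; congr (_%:E); rewrite /rho0 powRM// ?invr_ge0 ?(ltW c0)//.
  by rewrite indicE; case: (_ \in _); rewrite ?powR1// powR0// gt_eqF.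
rewrite ge0_integralZl//; last by rewrite lee_fin powR_ge0.
rewrite integral_indic// setIT mAc poweR_EFin -EFinM; congr (_%:E).
have cN0 : c != 0%R by rewrite gt_eqF.
rewrite -powR_inv1 ?(ltW c0)// -powRrM mulN1r opprB.
by rewrite powRB ?cN0 ?implybT// powRr1 ?(ltW c0)// divfK.
Qed.

(** Enlargements of [A] replace the set of [s]-intermediate points, which may
    fail to be Borel. *)
Lemma brunn_minkowski N (A B : set (borel M)) (s D theta : R) :
  separable M -> CD0 m N -> (1 < N)%R ->
  measurable A -> 0 < m A -> m A < +oo ->
  measurable B -> 0 < m B -> m B < +oo ->
  (0 <= D)%R -> (0 < s < 1)%R -> (0 < theta)%R ->
  (forall x y, A x -> B y -> (mdist (x : M) (y : M) <= D)%R) ->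
  (1 - s)%:E * m A `^ N^-1 + s%:E * m B `^ N^-1 <=
  m (enlargement A (s * D + theta)) `^ N^-1.
Proof.
move=> sM cd N1 mA A0 Ay mB B0 By D0 s01 theta0 AB.
have /andP[s0 s1] := s01.
have [muA muAE] := uniform_probability mA A0 Ay.
have [muB muBE] := uniform_probability mB B0 By.
have set_nonempty (E : set (borel M)) : 0 < m E -> E !=set0.
  by move=> E0; apply/set0P; apply: contraTneq E0 => ->; rewrite measure0 ltxx.
have [a Aa] := set_nonempty A A0; have [b Bb] := set_nonempty B B0.
have bounded_ac mu (E : set (borel M)) (y : M) :
    measurable E -> 0 < m E -> m E < +oo ->
    (forall F, mu F = ((fine (m E))^-1)%:E * m (F `&` E)) ->
    (forall x, E x -> (mdist y (x : M) <= D)%R) -> P2ac m mu.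
  move=> mE E0 Ey muE yE; split; last first.
    apply/null_content_dominatesP => F mF F0; rewrite muE.
    rewrite (_ : m (_ `&` _) = 0) ?mule0//; apply/eqP.
    by rewrite eq_le measure_ge0 andbT -F0 le_measure ?inE//; exact: measurableI.
  exists y; apply: (@le_lt_trans _ _ (\int[mu]__ (D ^+ 2)%:E)).
    apply: ae_ge0_le_integral => //.
    - by move=> x _; rewrite lee_fin sqr_ge0.
    - apply/measurable_EFinP; apply: measurable_funX.
      have my : measurable_fun setT (fun x : borel M => ((y : borel M), x)).
        by apply: measurable_fun_pair => //; exact: measurable_cst.
      exact: (measurableT_comp (measurable_mdist sM) my).
    - by move=> x _; rewrite lee_fin sqr_ge0.
    exists (~` E); split; first exact: measurableC.
      by rewrite [LHS]muE setICl measure0 mule0.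
    apply: subsetC => x Ex _; rewrite lee_fin ler_sqr ?nnegrE ?mdist_ge0//.
    exact: yE.
  have muT : mu setT = 1 := probability_setT mu.
  by rewrite integral_cst// [X in _ * X]muT mule1 ltry.
have acA : P2ac m muA.
  by apply: (bounded_ac _ _ b mA A0 Ay muAE) => x Ax; rewrite metric_sym AB.
have acB : P2ac m muB.
  by apply: (bounded_ac _ _ a mB B0 By muBE) => x Bx; rewrite AB.
have muAC : muA (~` A) = 0 by rewrite muAE setICl measure0 mule0.
have muBC : muB (~` B) = 0 by rewrite muBE setICl measure0 mule0.
have [Gamma [geo _ cvx]] := cd N (lexx N) _ _ acA acB.
have conc := geodesic_concentrated sM geo s01 D0 theta0 mA mB muAC muBC AB.
have sin : s \in `[0%R, 1%R] by rewrite in_itv /= !ltW.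
have := le_trans (Ent_ge N1 (measurable_enlargement _ _) conc) (cvx s sin).
rewrite (@Ent_uniform N muA A)// (@Ent_uniform N muB B)//.
rewrite !muleN -oppeD ?leeN2//.
have s1' : (0 <= 1 - s)%R by rewrite subr_ge0 ltW.
by apply: ge0_adde_def; rewrite inE mule_ge0 ?poweR_ge0// lee_fin ltW.
Qed.

End entropy.
(** * Bishop-Gromov monotonicity *)

Section bishop_gromov.
Context {R : realType} {M : completeMetricType R}.
Variable m : {measure set (borel M) -> \bar R}.
Variable N : R.
Hypotheses (N1 : 1 < N) (hM : mm_space m) (cd : CD0 m N).
Local Open Scope ereal_scope.

Let sM : separable M. Proof. by case: hM. Qed.
Let N0 : (0 < N)%R. Proof. exact: lt_trans ltr01 N1. Qed.

Lemma ball_gt0 (x : M) (r : R) : (0 < r)%R -> 0 < m (ball x r).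
Proof.
case: hM => _ _ _ full r0; apply: full; first exact: open_mball.
by exists x; exact: ballxx.
Qed.

Lemma le_mball (x : M) (r r' : R) :
  (r <= r')%R -> m (ball x r) <= m (ball x r').
Proof.
move=> rr'; rewrite le_measure ?inE//; try exact: measurable_mball.
exact: le_ball.
Qed.

(** The balls of finite measure whose centre is in a dense sequence and whose
    radius is the inverse of a positive integer cover the space. *)
Lemma mm_space_sigma_finite : sigma_finite setT m.
Proof.
have [a aP] := dense_sequence sM; have [_ _ lf _] := hM.
pose U (kn : nat * nat) : set (borel M) :=
  if m (ball (a kn.1) kn.2.+1%:R^-1) < +oo
  then ball (a kn.1) kn.2.+1%:R^-1 else set0.
exists (fun j => if unpickle j is Some kn then U kn else set0).
  apply/esym; rewrite -subTset => x _; have [r r0 xr] := lf x.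
  have [n nr] : exists n, (n.+1%:R^-1 < r / 2)%R.
    have r20 : (0 < r / 2)%R by rewrite divr_gt0.
    by have [n] := filter_ex (near_infty_natSinv_lt (PosNum r20)); exists n.
  have n0 : (0 < n.+1%:R^-1 :> R)%R by rewrite invr_gt0.
  have [k kx] := aP x _ n0.
  exists (pickle (k, n)) => //=; rewrite pickleK /U /= ifT.
    by rewrite ballEmdist.
  apply: le_lt_trans xr; rewrite le_measure ?inE//; try exact: measurable_mball.
  move=> y; rewrite !ballEmdist /= => ky.
  rewrite (le_lt_trans (metric_triangle _ (a k) _))// metric_sym.
  by rewrite [ltRHS]splitr ltrD// (lt_trans _ nr).
move=> j; case: (unpickle j) => [kn|]; last by rewrite measure0.
rewrite /U; case: ifPn => [kny|_]; last by rewrite measure0.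
by split=> //; exact: measurable_mball.
Qed.

(** Brunn-Minkowski from a small ball [ball x d] to [B] with [s < r / r']: for
    small [d] the enlargement stays inside [ball x r], so
    [s m(B)^(1/N) <= m(ball x r)^(1/N)], and then [s] tends to [r / r'].
    Subsets [B] of finite measure give access to a ball whose own measure is
    not yet known to be finite. *)
Lemma bishop_gromov_subset (x : M) (r r' : R) (B : set (borel M)) :
  (0 < r)%R -> (r < r')%R -> measurable B -> B `<=` ball x r' -> m B < +oo ->
  m B <= ((r' / r) `^ N)%:E * m (ball x r).
Proof.
move=> r0 rr' mB Br' By; have r'0 : (0 < r')%R := lt_trans r0 rr'.
have k0 : (0 < (r' / r) `^ N)%R by rewrite powR_gt0// divr_gt0.
have [B0|B0] := eqVneq (m B) 0.
  by rewrite B0 mule_ge0// lee_fin ltW.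
have {}B0 : 0 < m B by rewrite lt0e B0 measure_ge0.
have [rI|rfin] := eqVneq (m (ball x r)) +oo.
  by rewrite rI gt0_muley ?leey// lte_fin.
have rb : m (ball x r) < +oo by rewrite ltey.
have [_ _ /(_ x)[d0 d00 d0y] _] := hM.
pose b := (fine (m B) `^ N^-1)%R; pose v := (fine (m (ball x r)) `^ N^-1)%R.
have Bb : m B `^ N^-1 = b%:E by rewrite -poweR_EFin fineK// ge0_fin_numE.
have vb : m (ball x r) `^ N^-1 = v%:E by rewrite -poweR_EFin fineK// ge0_fin_numE.
have b0 : (0 < b)%R by rewrite powR_gt0// fine_gt0// B0.
have s_le s : (0 < s < r / r')%R -> (s * b <= v)%R.
  move=> /andP[s0 sr].
  have s1 : (s < 1)%R by rewrite (lt_trans sr)// ltr_pdivrMr// mul1r.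
  have srr : (s * r' < r)%R by rewrite -ltr_pdivlMr.
  pose d := (Num.min d0 ((r - s * r') / 3))%R.
  have dd0 : (0 < d)%R by rewrite lt_min d00 divr_gt0// subr_gt0.
  have d3 : (3 * d <= r - s * r')%R.
    by rewrite mulrC -ler_pdivlMr// /d ge_min lexx orbT.
  have Ay : m (ball x d) < +oo.
    by apply: le_lt_trans d0y; apply: le_mball; rewrite ge_min lexx.
  have s01 : (0 < s < 1)%R by rewrite s0 s1.
  have D0 : (0 <= r' + d)%R by rewrite ltW// addr_gt0.
  have AB (y z : M) : ball x d y -> B z -> (mdist y z <= r' + d)%R.
    move=> xy /Br' xz; rewrite (le_trans (metric_triangle _ x _))// metric_sym.
    by rewrite addrC lerD// ltW//; move: xy xz; rewrite !ballEmdist.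
  have := brunn_minkowski sM cd N1 (measurable_mball x d) (ball_gt0 x dd0) Ay
    mB B0 By D0 s01 dd0 AB.
  rewrite Bb => bm.
  have : s%:E * b%:E <= m (ball x r) `^ N^-1.
    apply: le_trans (le_trans bm _).
      by rewrite leeDr// mule_ge0 ?poweR_ge0// lee_fin subr_ge0 ltW.
    have Ni0 : (0 <= N^-1)%R by rewrite invr_ge0 ltW.
    apply: (gt0_ler_poweR Ni0); rewrite ?in_itv /= ?leey ?measure_ge0//.
    rewrite le_measure ?inE//; first exact: measurable_enlargement.
      exact: measurable_mball.
    move=> y [z]; rewrite !ballEmdist /= => xz yz.
    rewrite (le_lt_trans (metric_triangle _ z _))//.
    have sd : (s * d <= d)%R by rewrite ler_piMl// ltW.
    by move: yz; rewrite (metric_sym y); lra.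
  by rewrite vb -EFinM lee_fin.
have rb_le : (r / r' * b <= v)%R.
  rewrite leNgt; apply/negP => vrb.
  have q0 : (0 <= v / b)%R by rewrite divr_ge0 ?powR_ge0// ltW.
  have qr : (v / b < r / r')%R by rewrite ltr_pdivrMr.
  pose s := ((v / b + r / r') / 2)%R.
  have : (s * b <= v)%R by apply: s_le; rewrite /s; lra.
  by rewrite -ler_pdivlMr// /s; lra.
have : (b <= r' / r * v)%R.
  have -> : (b = r' / r * (r / r' * b))%R by field; rewrite !gt_eqF.
  by rewrite ler_pM2l// divr_gt0.
have rr0 : (0 <= r' / r)%R by rewrite divr_ge0// ltW.
have NN : (N^-1 * N = 1)%R by rewrite mulVf// gt_eqF.
have v0 : (0 <= r' / r * v)%R by rewrite mulr_ge0// powR_ge0.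
move=> /(ge0_ler_powR (ltW N0) (ltW b0) v0).
rewrite powRM// ?powR_ge0// -!powRrM NN !powRr1 ?fine_ge0//.
by rewrite -lee_fin EFinM !fineK ?ge0_fin_numE.
Qed.

(** Exhausting a ball of infinite measure by sets of finite measure would
    contradict [bishop_gromov_subset] for a concentric ball of finite
    measure. *)
Lemma ball_lty (x : M) (r : R) : m (ball x r) < +oo.
Proof.
have [_ _ /(_ x)[d d0 dy] _] := hM.
have [rd|dr] := leP r d; first exact: le_lt_trans (le_mball x rd) dy.
rewrite ltey; apply/eqP => ry.
have /sigma_finiteP[F [FT ndF Foo]] := mm_space_sigma_finite.
pose B n : set (borel M) := ball x r `&` F n.
have mB n : measurable (B n).
  by apply: measurableI; [exact: measurable_mball|have [] := Foo n].
have ndB : nondecreasing_seq B.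
  by move=> i j ij; apply/subsetPset; apply: setIS; exact/subsetPset/ndF.
have BT : \bigcup_n B n = ball x r by rewrite -setI_bigcupr -FT setIT.
have By : m (B n) @[n --> \oo] --> +oo.
  by rewrite -ry -BT; exact: nondecreasing_cvg_mu (bigcupT_measurable _ mB) ndB.
pose K := ((r / d) `^ N)%:E * m (ball x d).
have BK n : (m \o B) n <= K.
  apply: bishop_gromov_subset => //; first exact: subIsetl.
  apply: le_lt_trans (Foo n).2; rewrite le_measure ?inE//; last exact: subIsetr.
  by have [] := Foo n.
have : +oo <= K.
  rewrite -(cvg_lim _ By)//; apply: lime_le; first by apply/cvg_ex; exists +oo.
  exact: nearW.
rewrite leye_eq /K => /eqP; apply/eqP; rewrite -ltey lte_mul_pinfty//.
by rewrite lee_fin powR_ge0.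
Qed.

Definition volume (x : M) (r : R) : R := fine (m (ball x r)).

Lemma volumeE x r : m (ball x r) = (volume x r)%:E.
Proof. by rewrite fineK// ge0_fin_numE// ball_lty. Qed.

Lemma volume_gt0 x r : (0 < r)%R -> (0 < volume x r)%R.
Proof. by move=> r0; rewrite -lte_fin -volumeE ball_gt0. Qed.

Lemma bishop_gromov (x : M) (r r' : R) : (0 < r)%R -> (r <= r')%R ->
  (volume x r' / r' `^ N <= volume x r / r `^ N)%R.
Proof.
move=> r0; rewrite le_eqVlt => /predU1P[->//|rr'].
have r'0 : (0 < r')%R := lt_trans r0 rr'.
have := bishop_gromov_subset r0 rr' (measurable_mball x r') (@subset_refl _ _)
  (ball_lty x r').
rewrite !volumeE -EFinM lee_fin => vv.
rewrite ler_pdivrMr ?powR_gt0//; apply: (le_trans vv).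
rewrite powRM ?invr_ge0 ?(ltW r0) ?(ltW r'0)//.
rewrite -powR_inv1 ?(ltW r0)// -powRrM mulN1r powRN.
by rewrite le_eqVlt; apply/orP; left; apply/eqP; ring.
Qed.

End bishop_gromov.
(** * Asymptotic volume ratio *)

Section asymptotic_volume.
Context {R : realType} {M : completeMetricType R}.
Variable m : {measure set (borel M) -> \bar R}.
Variable N : R.
Hypotheses (N1 : 1 < N) (hM : mm_space m) (cd : CD0 m N).

Definition volume_ratio (x : M) (r : R) : R := volume m x r / r `^ N.

Lemma volume_ratio_ge0 x r : 0 <= volume_ratio x r.
Proof. by rewrite divr_ge0 ?powR_ge0// fine_ge0. Qed.

(** The number [l] is both a lower bound of [volume_ratio] and its limit at
    infinity: the lower bound serves the inequality, the limit its
    sharpness. *)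
Lemma AVR_volume_ratio (x : M) : exists l : R,
  [/\ 0 <= l, forall r, 0 < r -> l <= volume_ratio x r,
      forall e, 0 < e -> exists2 r, 0 < r & volume_ratio x r < l + e &
      AVR m N x = ((omega N)^-1 * l)%:E].
Proof.
(* Radii are truncated at 1 to get a function that is monotone on the whole
   line. *)
pose h r : \bar R := (volume_ratio x (Num.max r 1))%:E.
have max0 r : 0 < Num.max r 1 :> R by rewrite lt_max ltr01 orbT.
have h_noninc : nonincreasing_fun h.
  move=> r r' rr'; rewrite lee_fin; apply: bishop_gromov => //.
  by rewrite ge_max !le_max rr' lexx !orbT.
have h_cvg := nonincreasing_cvge h_noninc; set L := ereal_inf _ in h_cvg.
have L0 : (0 <= L)%E.
  by apply: le_ereal_inf_tmp => _ [r _ <-]; rewrite lee_fin volume_ratio_ge0.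
have Lh r : (L <= h r)%E by apply: ereal_inf_lbound; exists r.
have Lfin : L \is a fin_num.
  by rewrite ge0_fin_numE// (le_lt_trans (Lh 1))// ltry.
exists (fine L); split.
- exact: fine_ge0.
- move=> r r0; rewrite -lee_fin fineK// (le_trans (Lh r))// lee_fin.
  by apply: bishop_gromov => //; rewrite le_max lexx.
- move=> e e0.
  have /ereal_inf_lt[_ [r _ <-]] : (L < (fine L + e)%:E)%E.
    by rewrite -{1}(fineK Lfin) lte_fin ltrDl.
  by rewrite lte_fin; exists (Num.max r 1).
apply: cvg_lim => //.
rewrite EFinM fineK//.
apply: cvg_trans (cvgeZl _ h_cvg); last by [].
apply: near_eq_cvg; near=> r.
have r1 : 1 <= r by near: r; exact: nbhs_pinfty_ge.
rewrite /h max_l// (volumeE N1 hM cd) -!EFinM; congr (_%:E).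
by rewrite /volume_ratio; move: (omega N) => w; rewrite invfM; ring.
Unshelve. all: by end_near. Qed.

Lemma omega_ge0 : 0 <= omega N.
Proof.
rewrite divr_ge0 ?powR_ge0//; apply: Rintegral_ge0 => y _.
by rewrite mulr_ge0 ?powR_ge0// expR_ge0.
Qed.

End asymptotic_volume.

(** * Isoperimetric inequality *)

Section minkowski.
Context {R : realType} {M : completeMetricType R}.
Variable m : {measure set (borel M) -> \bar R}.
Local Open Scope ereal_scope.

Lemma minkowski_content_ge (Omega : set M) (K : \bar R) :
  (forall e : R, (0 < e)%R ->
    K <= m (enlargement Omega e `\` Omega) * (e^-1)%:E) ->
  K <= minkowski_content m Omega.
Proof.
move=> Kle; rewrite /minkowski_content limf_einfE.
apply: le_ereal_sup_tmp.
exists (ereal_inf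
  ((fun e : R => m (enlargement Omega e `\` Omega) * (e^-1)%:E) @`
  [set e | 0 < e]%R)).
  by eexists; [|reflexivity]; exact: nbhs_right_gt.
by apply: le_ereal_inf_tmp => _ [e e0 <-]; exact: Kle.
Qed.

Lemma minkowski_content_le (Omega : set M) (K : \bar R) :
  (\forall e \near 0^'+, m (enlargement Omega e `\` Omega) * (e^-1)%:E <= K) ->
  minkowski_content m Omega <= K.
Proof.
move=> leK; rewrite /minkowski_content limf_einfE.
apply: ge_ereal_sup => _ [V V0 <-].
have [e [Ve eK]] := filter_ex (filterI V0 leK).
by apply: le_trans eK; apply: ereal_inf_lbound; exists e.
Qed.

End minkowski.
Section isoperimetric.
Context {R : realType} {M : completeMetricType R}.
Variable m : {measure set (borel M) -> \bar R}.
Variable N : R.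
Hypotheses (N1 : 1 < N) (hM : mm_space m) (cd : CD0 m N).
Variables (x0 : M) (l : R).

Let sM : separable M. Proof. by case: hM. Qed.
Let N0 : 0 < N. Proof. exact: lt_trans ltr01 N1. Qed.

Lemma enlargement_ball (x : M) (r e : R) (A : set M) :
  A `<=` ball x r -> enlargement A e `<=` ball x (r + e).
Proof.
move=> Ar y [z /Ar]; rewrite !ballEmdist /= => xz yz.
by rewrite (le_lt_trans (metric_triangle _ z _))// (metric_sym z) ltrD.
Qed.

Lemma bounded_subset_center (x : M) (A : set M) : bounded_subset A ->
  exists2 r : R, 0 < r & A `<=` ball x r.
Proof.
case=> y [r Ar]; exists (mdist x y + Num.max r 1).
  by rewrite ltr_wpDl ?mdist_ge0// lt_max ltr01 orbT.
move=> z /Ar; rewrite !ballEmdist /= => yz.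
rewrite (le_lt_trans (metric_triangle _ y _))// ltrD2l.
by rewrite (lt_le_trans yz)// le_max lexx.
Qed.

Section lower_bound.
Hypotheses (l0 : 0 < l) (l_le : forall r, 0 < r -> l <= volume_ratio m N x0 r).
Variable Omega : set (borel M).
Hypotheses (mO : measurable Omega) (bO : bounded_subset Omega).

Let kappa := l `^ N^-1.
Let kappa0 : 0 < kappa. Proof. by rewrite powR_gt0. Qed.

Lemma bounded_lty (A : set (borel M)) : measurable A -> bounded_subset A ->
  (m A < +oo)%E.
Proof.
move=> mA [x [r Ar]]; apply: le_lt_trans (ball_lty N1 hM cd x r).
by rewrite le_measure ?inE//; exact: measurable_mball.
Qed.

(** Brunn-Minkowski from [Omega] to [ball x0 r] with [s = e' / (r + r0)], where
    [e' < e] and [Omega] lies in [ball x0 r0]: the enlargement has width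
    [s (r + r0) + (e - e') = e], and [s m(B_r)^(1/N) >= s kappa r].
    Letting [r] tend to infinity and then [e'] to [e] gives the claim. *)
Lemma enlargement_volume_root (e : R) : 0 < e -> (0 < m Omega)%E ->
  fine (m Omega) `^ N^-1 + kappa * e <= fine (m (enlargement Omega e)) `^ N^-1.
Proof.
move=> e0 Opos; have Oy := bounded_lty mO bO.
have [r0 r00 Or] := bounded_subset_center x0 bO.
have mOe := measurable_enlargement Omega e.
have Oey : (m (enlargement Omega e) < +oo)%E.
  apply: bounded_lty => //; exists x0, (r0 + e); exact: enlargement_ball.
pose alpha := fine (m Omega) `^ N^-1.
pose w := fine (m (enlargement Omega e)) `^ N^-1.
have al0 : 0 <= alpha by rewrite powR_ge0.
rewrite -/alpha -/w.
have far_ball e' r : 0 < e' < e -> e < r ->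
    alpha + e' * kappa <= w + e' * (alpha + kappa * r0) / (r + r0).
  move=> /andP[e'0 e'e] er; have r_gt0 : 0 < r := lt_trans e0 er.
  have rr0 : 0 < r + r0 by rewrite addr_gt0.
  pose s := e' / (r + r0).
  have s01 : 0 < s < 1.
    rewrite divr_gt0//= ltr_pdivrMr// mul1r (lt_trans e'e)//.
    by rewrite (lt_trans er)// ltrDl.
  have th0 : 0 < e - e' by rewrite subr_gt0.
  have AB (y z : M) : Omega y -> ball x0 r z -> mdist y z <= r + r0.
    move=> /Or xy xz; rewrite (le_trans (metric_triangle _ x0 _))// metric_sym.
    by rewrite addrC lerD// ltW//; move: xy xz; rewrite !ballEmdist.
  have := brunn_minkowski sM cd N1 mO Opos Oy (measurable_mball x0 r)
    (ball_gt0 hM x0 r_gt0) (ball_lty N1 hM cd x0 r) (ltW rr0) s01 th0 AB.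
  have sr : s * (r + r0) = e' by rewrite /s divfK// gt_eqF.
  rewrite sr subrKC (volumeE N1 hM cd).
  rewrite -(@fineK _ (m Omega)) ?ge0_fin_numE//.
  rewrite -[X in (_ <= X `^ _)%E]fineK ?ge0_fin_numE//.
  rewrite !poweR_EFin -!EFinM -EFinD lee_fin -/alpha -/w.
  have s0 : 0 < s by case/andP: s01.
  have kv : kappa * r <= volume m x0 r `^ N^-1.
    have := l_le r_gt0; rewrite /volume_ratio ler_pdivlMr ?powR_gt0// => lv.
    have -> : kappa * r = (l * r `^ N) `^ N^-1.
      by rewrite powRM ?powR_ge0 ?(ltW l0)// -powRrM mulfV ?gt_eqF// powRr1 ?ltW.
    apply: ge0_ler_powR => //; rewrite ?nnegrE ?invr_ge0 ?(ltW N0)//.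
    - by rewrite mulr_ge0 ?powR_ge0// ltW.
    - by rewrite fine_ge0.
  have skv : s * (kappa * r) <= s * volume m x0 r `^ N^-1 by rewrite ler_pM2l.
  have -> : e' * (alpha + kappa * r0) / (r + r0) = s * (alpha + kappa * r0).
    by rewrite /s mulrAC.
  have -> : e' * kappa = s * (kappa * r) + s * (kappa * r0).
    by rewrite -sr; ring.
  by lra.
have e'_le e' : 0 < e' < e -> alpha + e' * kappa <= w.
  move=> ee; have /andP[e'0 _] := ee; apply/ler_addgt0Pl => eta eta0.
  (* The radius below makes the error term of [far_ball] at most [eta]. *)
  pose c := e' * (alpha + kappa * r0).
  have c0 : 0 <= c by rewrite mulr_ge0 ?addr_ge0 ?mulr_ge0// ltW.
  have d0 : 0 <= c / eta by rewrite divr_ge0// ltW.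
  have er : e < c / eta + e + 1 by lra.
  rewrite (le_trans (far_ball _ _ ee er))// addrC lerD2r -/c.
  rewrite ler_pdivrMr; last by lra.
  rewrite -[leLHS](divfK (lt0r_neq0 eta0)) [leLHS]mulrC ler_pM2l//; lra.
apply/ler_addgt0Pl => eta eta0.
(* The first entry keeps [e'] positive, the second makes
   [(e - e') * kappa <= eta]. *)
pose e' := Num.max (e / 2) (e - eta / kappa).
have e'e : 0 < e' < e.
  rewrite lt_max gt_max divr_gt0//= ltr_pdivrMr// ltrBlDr ltrDl divr_gt0// andbT.
  by lra.
have := e'_le _ e'e.
have : (e - eta / kappa) * kappa <= e' * kappa.
  by rewrite ler_pM2r// le_max lexx orbT.
rewrite mulrBl divfK ?gt_eqF//; lra.
Qed.

(** With [alpha = m(Omega)^(1/N)], Bernoulli's inequality gives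
    [(alpha + kappa e)^N >= alpha^N + N kappa e alpha^(N - 1)], so every
    difference quotient, and not only the lower limit, satisfies the bound. *)
Lemma minkowski_content_lower_bound :
  ((N * kappa)%:E * m Omega `^ ((N - 1) / N) <= minkowski_content m Omega)%E.
Proof.
apply: minkowski_content_ge => e e0.
have [Opos|Opos] := eqVneq (m Omega) 0%E.
  rewrite Opos poweR0r; last by rewrite mulf_neq0 ?invr_eq0 ?gt_eqF// subr_gt0.
  by rewrite mule0 mule_ge0// lee_fin invr_ge0 ltW.
have {Opos}Opos : (0 < m Omega)%E by rewrite lt0e Opos measure_ge0.
have Oy := bounded_lty mO bO.
have root_le := enlargement_volume_root e0 Opos.
have [r0 r00 Or] := bounded_subset_center x0 bO.
have mOe := measurable_enlargement Omega e.
have Oey : (m (enlargement Omega e) < +oo)%E.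
  apply: bounded_lty => //; exists x0, (r0 + e); exact: enlargement_ball.
have mD : measurable (enlargement Omega e `\` Omega : set (borel M)).
  exact: measurableD.
have Dy : (m (enlargement Omega e `\` Omega) < +oo)%E.
  by apply: le_lt_trans Oey; rewrite le_measure ?inE//; exact: subDsetl.
pose a := fine (m Omega); pose v := fine (m (enlargement Omega e)).
pose b := fine (m (enlargement Omega e `\` Omega)).
have aE : m Omega = a%:E by rewrite fineK// ge0_fin_numE.
have bE : m (enlargement Omega e `\` Omega) = b%:E by rewrite fineK// ge0_fin_numE.
have vE : m (enlargement Omega e) = v%:E by rewrite fineK// ge0_fin_numE.
have a0 : 0 < a by rewrite -lte_fin -aE.
have vab : v <= a + b.
  rewrite -lee_fin EFinD -vE -aE -bE.
  apply: le_trans (measureU2 _ mO mD); rewrite le_measure ?inE//.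
    exact: measurableU.
  by move=> y Oy'; case: (pselect (Omega y)) => [|nO]; [left|right].
rewrite -/a -/v in root_le.
rewrite aE bE poweR_EFin -!EFinM lee_fin ler_pdivlMr//.
apply: (@le_trans _ _ (v - a)); last by rewrite lerBlDl.
pose alpha := a `^ N^-1.
have al0 : 0 < alpha by rewrite powR_gt0.
have aal : a = alpha `^ N by rewrite /alpha -powRrM mulVf ?gt_eqF// powRr1 ?ltW.
have v_ge : alpha `^ N * (1 + kappa * e / alpha) `^ N <= v.
  have t0 : 0 <= kappa * e / alpha.
    by rewrite divr_ge0 ?mulr_ge0// ltW.
  rewrite -powRM ?(ltW al0) ?addr_ge0// mulrDr mulr1 mulrC divfK ?gt_eqF//.
  have -> : v = (v `^ N^-1) `^ N.
    by rewrite -powRrM mulVf ?gt_eqF// powRr1// fine_ge0.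
  apply: ge0_ler_powR => //; rewrite ?nnegrE ?powR_ge0 ?(ltW N0)//.
  by rewrite addr_ge0 ?(ltW al0)// mulr_ge0// ltW.
have t0 : 0 <= 1 + N * (kappa * e / alpha).
  by rewrite addr_ge0// mulr_ge0 ?(ltW N0)// divr_ge0 ?mulr_ge0// ltW.
have := bernoulli_powR N1 t0.
move=> /(ler_wpM2l (ltW a0)); rewrite {2}aal => /le_trans/(_ v_ge).
rewrite mulrDr mulr1 -lerBrDl; apply: le_trans.
rewrite le_eqVlt; apply/orP; left; apply/eqP.
have -> : (N - 1) / N = 1 - N^-1 by rewrite mulrBl mulfV ?gt_eqF// mul1r.
by rewrite powRB ?(lt0r_neq0 a0) ?implybT// powRr1 ?(ltW a0)// -/alpha; ring.
Qed.

End lower_bound.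

Section sharpness.
Hypothesis l_adherent :
  forall e, 0 < e -> exists2 r, 0 < r & volume_ratio m N x0 r < l + e.

(** The enlargement of [ball x0 r] by [e] lies in [ball x0 (r + e)], and
    Bishop-Gromov bounds the growth of the volume by the factor
    [(1 + e / r)^N]; the derivative of the latter at [e = 0] is [N / r]. *)
Lemma minkowski_content_ball_le (r : R) : 0 < r ->
  (minkowski_content m (ball x0 r) <= (N * volume m x0 r / r)%:E)%E.
Proof.
move=> r0; set V := volume m x0 r; pose L := N * V / r.
have V0 : 0 < V := volume_gt0 N1 hM cd x0 r0.
have L0 : 0 < L by rewrite divr_gt0// mulr_gt0.
apply/lee_addgt0Pr => eta eta0; rewrite -EFinD.
have Le0 : 0 < L + eta by rewrite addr_gt0.
apply: minkowski_content_le; near=> e.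
have e0 : 0 < e by near: e; exact: nbhs_right_gt.
pose t := e / r; have t0 : 0 < t by rewrite divr_gt0.
(* For such [t] the quotient [L / (1 - N * t)] is at most [L + eta]. *)
have Nt : N * t < eta / (L + eta).
  rewrite /t mulrA ltr_pdivrMr// mulrC -ltr_pdivlMr//.
  near: e; apply: nbhs_right_lt.
  by rewrite divr_gt0// mulr_gt0// divr_gt0.
have Nt1 : L / (L + eta) <= 1 - N * t.
  have -> : L / (L + eta) = 1 - eta / (L + eta) by field; rewrite gt_eqF.
  by rewrite lerD2l lerN2 ltW.
have q0 : 0 < 1 - N * t by rewrite (lt_le_trans _ Nt1)// divr_gt0.
have mD : measurable (enlargement (ball x0 r) e `\` ball x0 r : set (borel M)).
  by apply: measurableD; [exact: measurable_enlargement|exact: measurable_mball].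
have sub : enlargement (ball x0 r) e `\` ball x0 r `<=`
    ball x0 (r + e) `\` ball x0 r.
  by apply: setSD; exact: enlargement_ball.
have D_le : (m (enlargement (ball x0 r) e `\` ball x0 r) <=
    (volume m x0 (r + e) - V)%:E)%E.
  have mD' : measurable (ball x0 (r + e) `\` ball x0 r : set (borel M)).
    by apply: measurableD; exact: measurable_mball.
  apply: (@le_trans _ _ (m (ball x0 (r + e) `\` ball x0 r))).
    by rewrite le_measure ?inE.
  have sub_ball : ball x0 r `<=` ball x0 (r + e).
    by apply: le_ball; rewrite lerDl ltW.
  have -> : m (ball x0 (r + e) `\` ball x0 r) =
      (m (ball x0 (r + e)) - m (ball x0 r))%E.
    rewrite -{2}(setIidr sub_ball); apply: measureD; try exact: measurable_mball.
    exact: (ball_lty N1 hM cd).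
  by rewrite !(volumeE N1 hM cd) -EFinB.
apply: (@le_trans _ _ ((volume m x0 (r + e) - V) * e^-1)%:E).
  by rewrite EFinM lee_wpmul2r// lee_fin invr_ge0 ltW.
rewrite lee_fin ler_pdivrMr//.
have growth : volume m x0 (r + e) <= V * (1 + t) `^ N.
  have := bishop_gromov N1 hM cd x0 r0 (_ : r <= r + e).
  rewrite lerDl (ltW e0) => /(_ isT); rewrite -/V.
  rewrite ler_pdivrMr ?powR_gt0 ?addr_gt0// => h; apply: (le_trans h).
  have -> : r + e = r * (1 + t) by rewrite mulrDr mulr1 mulrC divfK// gt_eqF.
  rewrite powRM ?(ltW r0)//; last by rewrite addr_ge0// ltW.
  by rewrite mulrA divfK// gt_eqF// powR_gt0.
(* Bernoulli's inequality at [- t / (1 + t)], since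
   [1 - t / (1 + t) = (1 + t)^-1]. *)
have upper : (1 + t) `^ N <= (1 - N * t)^-1.
  have t1 : 0 < 1 + t by rewrite addr_gt0.
  have tt : 0 <= t / (1 + t) <= t.
    rewrite divr_ge0 ?(ltW t0) ?(ltW t1)//= ler_pdivrMr// ler_peMr ?(ltW t0)//.
    by rewrite lerDl ltW.
  have Ntt : 1 - N * t <= 1 + N * - (t / (1 + t)).
    by rewrite lerD2l mulrN lerN2 ler_pM2l//; case/andP: tt.
  have := bernoulli_powR N1 (le_trans (ltW q0) Ntt).
  have -> : 1 - t / (1 + t) = (1 + t)^-1 by field; rewrite gt_eqF.
  move=> /(le_trans Ntt); rewrite -powR_inv1 ?(ltW t1)// -powRrM mulN1r powRN => h.
  by rewrite -[leLHS]invrK lef_pV2 ?posrE ?invr_gt0 ?powR_gt0.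
have : V * (1 + t) `^ N <= V * (1 - N * t)^-1 by rewrite ler_pM2l.
have -> : V * (1 - N * t)^-1 = V + V * (N * t) / (1 - N * t).
  by field; rewrite gt_eqF.
have : V * (N * t) / (1 - N * t) <= (L + eta) * e.
  rewrite ler_pdivrMr//.
  have -> : V * (N * t) = L * e by rewrite /L /t; field; rewrite gt_eqF.
  by rewrite [leRHS]mulrAC ler_pM2r// [leRHS]mulrC -ler_pdivrMr.
rewrite -/L; lra.
Unshelve. all: by end_near. Qed.

Lemma isoperimetric_constant_le (C : R) : 0 < C ->
  isoperimetric_inequality m N C%:E -> C <= N * l `^ N^-1.
Proof.
move=> C0 iso.
have C_le r : 0 < r -> C <= N * volume_ratio m N x0 r `^ N^-1.
  move=> r0; have V0 : 0 < volume m x0 r := volume_gt0 N1 hM cd x0 r0.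
  have bb : bounded_subset (ball x0 r) by exists x0, r.
  have := le_trans (iso _ (measurable_mball x0 r) bb)
    (minkowski_content_ball_le r0).
  rewrite (volumeE N1 hM cd) poweR_EFin -EFinM lee_fin.
  set V := volume _ _ _ in V0 *.
  have -> : (N - 1) / N = 1 - N^-1 by rewrite mulrBl mulfV ?gt_eqF// mul1r.
  rewrite powRB ?(lt0r_neq0 V0) ?implybT// powRr1 ?(ltW V0)// => h.
  rewrite /volume_ratio -/V powRM ?invr_ge0 ?powR_ge0 ?(ltW V0)//.
  have -> : (r `^ N)^-1 `^ N^-1 = r^-1.
    by rewrite -powRN -powRrM mulNr mulfV ?gt_eqF// powR_inv1// ltW.
  have Vi : 0 < V `^ N^-1 by rewrite powR_gt0.
  move: h; rewrite [leLHS]mulrA ler_pdivrMr// => h.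
  rewrite -(ler_pM2r V0) (le_trans h)// le_eqVlt; apply/orP; left; apply/eqP; ring.
have CN0 : 0 <= C / N by rewrite divr_ge0 ?ltW.
have CNl : (C / N) `^ N <= l.
  apply/ler_addgt0Pl => e e0; have [r r0 re] := l_adherent e0.
  rewrite addrC (le_trans _ (ltW re))//.
  have := C_le _ r0; rewrite mulrC -ler_pdivrMr// => h.
  have := ge0_ler_powR (ltW N0) _ _ h; rewrite !nnegrE => /(_ CN0 (powR_ge0 _ _)).
  by rewrite -powRrM mulVf ?gt_eqF// powRr1// volume_ratio_ge0.
have l0 : 0 <= l by apply: le_trans CNl; exact: powR_ge0.
rewrite mulrC -ler_pdivrMr//.
have -> : C / N = ((C / N) `^ N) `^ N^-1.
  by rewrite -powRrM mulfV ?gt_eqF// powRr1.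
by apply: ge0_ler_powR => //; rewrite ?nnegrE ?powR_ge0// invr_ge0 ltW.
Qed.

End sharpness.

End isoperimetric.
Theorem theorem1p1 (R : realType) (M : completeMetricType R)
  (m : {measure set (borel M) -> \bar R}) (N : R) (x0 : M)
  (hN : 1 < N) (hM : mm_space m) (hCD : CD0 m N)
  (hAVR : (0 < AVR m N x0)%E) :
  isoperimetric_inequality m N
    ((N * omega N `^ N^-1)%:E * AVR m N x0 `^ N^-1)%E /\
  (forall C : R,
    ((N * omega N `^ N^-1)%:E * AVR m N x0 `^ N^-1 < C%:E)%E ->
    ~ isoperimetric_inequality m N C%:E).
Proof.
have [l [l0 l_le l_adh AVRl]] := AVR_volume_ratio hN hM hCD x0.
have N0 : 0 < N := lt_trans ltr01 hN.
(* If [omega N] were 0, then [(omega N)^-1 = 0] and [AVR] would vanish. *)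
have om0 : 0 < omega N.
  rewrite lt_neqAle omega_ge0 andbT; apply: contraTneq hAVR => om.
  by rewrite AVRl -om invr0 mul0r ltxx.
have {}l0 : 0 < l.
  move: hAVR; rewrite AVRl lte_fin; move: (omega N) om0 => w w0.
  by rewrite pmulr_rgt0// invr_gt0.
have -> : ((N * omega N `^ N^-1)%:E * AVR m N x0 `^ N^-1 =
    (N * l `^ N^-1)%:E)%E.
  rewrite AVRl poweR_EFin -EFinM; move: (omega N) om0 => w w0.
  have wl0 : 0 <= w^-1 * l by rewrite mulr_ge0 ?invr_ge0 ?(ltW w0) ?(ltW l0).
  by rewrite -mulrA -powRM ?(ltW w0)// mulVKf ?gt_eqF.
split=> [A mA bA|C lC iso].
  exact: (minkowski_content_lower_bound hN hM hCD l0 l_le mA bA).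
have C0 : 0 < C.
  by rewrite -lte_fin (le_lt_trans _ lC)// lee_fin mulr_ge0 ?powR_ge0// ltW.
have := isoperimetric_constant_le hN hM hCD l_adh C0 iso.
by rewrite leNgt; move: lC; rewrite lte_fin => ->.
Qed.
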